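(* Let $(S,\mathcal{C})$ be a stratifold with structure sheaf $\mathcal{O}_S$, and let $i:\mathrm{Spec}_r\,\mathcal{O}_S(S)\to\mathrm{Spec}\,\mathcal{O}_S(S)$ be the inclusion. Then $(S,\mathcal{O}_S)$ is isomorphic as a ringed space to $i^*(\mathrm{Spec}\,\mathcal{O}_S(S),\widetilde{\mathcal{O}_S(S)})$, where $(\mathrm{Spec}\,\mathcal{O}_S(S),\widetilde{\mathcal{O}_S(S)})$ is the affine scheme associated with the ring $\mathcal{O}_S(S)$.
   Context: A differential space is a pair $(S,\mathcal{C})$ of a topological space $S$ and an $\mathbb{R}$-subalgebra $\mathcal{C}$ of the algebra $C^0(S)$ of continuous real-valued functions on $S$ which is locally detectable ($f\in\mathcal{C}$ if and only if for every $x\in S$ there are an open neighborhood $U$ of $x$ and $g\in\mathcal{C}$ with $f|_U=g|_U$) and $C^\infty$-closed (for all $n\ge 1$, $f_1,\dots,f_n\in\mathcal{C}$ and smooth $g:\mathbb{R}^n\to\mathbb{R}$, the function $x\mapsto g(f_1(x),\dots,f_n(x))$ is in $\mathcal{C}$). For $x\in S$, $\mathcal{C}_x$ is the algebra of germs at $x$ of elements of $\mathcal{C}$ and $T_xS$ is the vector space of derivations of $\mathcal{C}_x$ (at $x$, i.e. into $\mathbb{R}$ via evaluation at $x$). A stratifold is a differential space $(S,\mathcal{C})$ such that: (1) $S$ is locally compact Hausdorff with countable basis; (2) the skeleta $sk_k(S)=\{x\in S\mid \dim T_xS\le k\}$ are closed in $S$; (3) for each $x\in S$ and open neighborhood $U$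 of $x$ there is a non-negative $\rho\in\mathcal{C}$ with $\rho(x)\ne0$ and $\mathrm{supp}\,\rho\subset U$; (4) the strata $S^k:=sk_k(S)-sk_{k-1}(S)$ are $k$-dimensional smooth manifolds such that restriction along $S^k\hookrightarrow S$ induces an isomorphism $\mathcal{C}_x\to C^\infty(S^k)_x$ for each $x\in S^k$. All stratifolds are assumed finite-dimensional: $S=sk_n(S)$ for some $n\ge 0$. The structure sheaf $\mathcal{O}_S$ assigns to an open $U\subset S$ the algebra $\mathcal{O}_S(U)=\mathcal{C}_U\subset C^0(U)$ of locally extendable functions, i.e. those $g$ such that each $x\in U$ has an open neighborhood $V\subset U$ and $h\in\mathcal{C}$ with $g|_V=h|_V$; in particular $\mathcal{O}_S(S)=\mathcal{C}$. For an $\mathbb{R}$-algebra $A$, the real spectrum $\mathrm{Spec}_r A$ is the set of maximal ideals $\mathfrak{m}$ of $A$ with $A/\mathfrak{m}\cong\mathbb{R}$ as $\mathbb{R}$-algebras, a subspace of the prime spectrum $\mathrm{Spec}\,A$ with the Zariski topology. The ringed space $i^*(\mathrm{Spec}\,A,\widetilde A)$ is $\mathrm{Spec}_rA$ with the inverse image sheaf of $\widetilde A$ along $i:\mathrm{Spec}_rA\hookrightarrow\mathrm{Spec}\,A$; equivalently the sheafification $\widehat A$ of the presheaf $U\mapsto M_U^{-1}A$ where $M_U=\bigcap_{\mathfrak{m}\in U}(A\setminus\mathfrak{m})$. *)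

(* Defs.v *)
From HB Require Import structures.
From mathcomp Require Import all_boot generic_quotient all_order all_algebra.
From mathcomp Require Import all_classical all_reals all_analysis ring.
Import Order.TTheory GRing.Theory Num.Theory.
Import numFieldNormedType.Exports.

Set Implicit Arguments.
Unset Strict Implicit.
Unset Printing Implicit Defensive.

Local Open Scope classical_set_scope.
Local Open Scope ring_scope.

(* Rings here are `comPzRingType`s, possibly zero: the sections of a sheaf of
   rings over the empty set form the zero ring.  The algebra structures of the
   library exclude the zero ring, so an R-algebra is a ring A together with a
   ring morphism R -> A. *)

Record ring_setoid := RingSetoid {
  rs_car :> Type;
  rs_eq : rs_car -> rs_car -> Prop;
  rs_zero : rs_car;
  rs_one : rs_car;
  rs_opp : rs_car -> rs_car;
  rs_add : rs_car -> rs_car -> rs_car;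
  rs_mul : rs_car -> rs_car -> rs_car;
  rs_refl : forall a, rs_eq a a;
  rs_sym : forall a b, rs_eq a b -> rs_eq b a;
  rs_trans : forall a b c, rs_eq a b -> rs_eq b c -> rs_eq a c;
  rs_oppE : forall a a', rs_eq a a' -> rs_eq (rs_opp a) (rs_opp a');
  rs_addE : forall a a' b b', rs_eq a a' -> rs_eq b b' ->
    rs_eq (rs_add a b) (rs_add a' b');
  rs_mulE : forall a a' b b', rs_eq a a' -> rs_eq b b' ->
    rs_eq (rs_mul a b) (rs_mul a' b');
  rs_addA : forall a b c,
    rs_eq (rs_add a (rs_add b c)) (rs_add (rs_add a b) c);
  rs_addC : forall a b, rs_eq (rs_add a b) (rs_add b a);
  rs_add0 : forall a, rs_eq (rs_add rs_zero a) a;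
  rs_addN : forall a, rs_eq (rs_add (rs_opp a) a) rs_zero;
  rs_mulA : forall a b c,
    rs_eq (rs_mul a (rs_mul b c)) (rs_mul (rs_mul a b) c);
  rs_mulC : forall a b, rs_eq (rs_mul a b) (rs_mul b a);
  rs_mul1 : forall a, rs_eq (rs_mul rs_one a) a;
  rs_mulD : forall a b c,
    rs_eq (rs_mul (rs_add a b) c) (rs_add (rs_mul a c) (rs_mul b c))
}.

Section RingSetoidQuotient.
Variable E : ring_setoid.

Definition rs_rel : rel {classic E} := fun a b => `[< rs_eq (a : E) b >].

Lemma rs_rel_refl : reflexive rs_rel.
Proof. by move=> a; apply/asboolP; exact: rs_refl. Qed.

Lemma rs_rel_sym : symmetric rs_rel.
Proof. by move=> a b; apply/asboolP/asboolP; exact: rs_sym. Qed.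

Lemma rs_rel_trans : transitive rs_rel.
Proof.
move=> b a c /asboolP ab /asboolP bc; apply/asboolP; exact: rs_trans ab bc.
Qed.

Definition rs_equiv := EquivRel rs_rel rs_rel_refl rs_rel_sym rs_rel_trans.

Definition rs_quot := {eq_quot rs_equiv}%qT.
HB.instance Definition _ := Choice.on rs_quot.

Definition rs_class (a : E) : rs_quot := (\pi_({eq_quot rs_equiv}) a)%qT.
Definition rs_repr (q : rs_quot) : E := repr (q : {eq_quot rs_equiv}%qT).

Lemma rs_reprK q : rs_class (rs_repr q) = q.
Proof. exact: reprK. Qed.

Lemma rs_classP a b : rs_class a = rs_class b <-> rs_eq a b.
Proof.
split=> [/eqP|ab]; first by rewrite eqmodE => /asboolP.
by apply/eqP; rewrite eqmodE; apply/asboolP.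
Qed.

Lemma rs_class_repr a : rs_eq (rs_repr (rs_class a)) a.
Proof. by apply/rs_classP; rewrite rs_reprK. Qed.

Let zeroq := rs_class (rs_zero E).
Let oneq := rs_class (rs_one E).
Let oppq p := rs_class (rs_opp (rs_repr p)).
Let addq p q := rs_class (rs_add (rs_repr p) (rs_repr q)).
Let mulq p q := rs_class (rs_mul (rs_repr p) (rs_repr q)).

Let oppqE a : oppq (rs_class a) = rs_class (rs_opp a).
Proof. by apply/rs_classP/rs_oppE; exact: rs_class_repr. Qed.

Let addqE a b : addq (rs_class a) (rs_class b) = rs_class (rs_add a b).
Proof. by apply/rs_classP/rs_addE; exact: rs_class_repr. Qed.

Let mulqE a b : mulq (rs_class a) (rs_class b) = rs_class (rs_mul a b).
Proof. by apply/rs_classP/rs_mulE; exact: rs_class_repr. Qed.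

Let addqA : associative addq.
Proof.
move=> p q r; rewrite -(rs_reprK p) -(rs_reprK q) -(rs_reprK r) !addqE.
by apply/rs_classP; exact: rs_addA.
Qed.

Let addqC : commutative addq.
Proof.
move=> p q; rewrite -(rs_reprK p) -(rs_reprK q) !addqE.
by apply/rs_classP; exact: rs_addC.
Qed.

Let add0q : left_id zeroq addq.
Proof.
by move=> p; rewrite -(rs_reprK p) addqE; apply/rs_classP; exact: rs_add0.
Qed.

Let addNq : left_inverse zeroq oppq addq.
Proof.
move=> p; rewrite -(rs_reprK p) oppqE addqE.
by apply/rs_classP; exact: rs_addN.
Qed.

HB.instance Definition _ := GRing.isZmodule.Build rs_quot
  addqA addqC add0q addNq.

Let mulqA : associative mulq.
Proof.
move=> p q r; rewrite -(rs_reprK p) -(rs_reprK q) -(rs_reprK r) !mulqE.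
by apply/rs_classP; exact: rs_mulA.
Qed.

Let mulqC : commutative mulq.
Proof.
move=> p q; rewrite -(rs_reprK p) -(rs_reprK q) !mulqE.
by apply/rs_classP; exact: rs_mulC.
Qed.

Let mul1q : left_id oneq mulq.
Proof.
by move=> p; rewrite -(rs_reprK p) mulqE; apply/rs_classP; exact: rs_mul1.
Qed.

Let mulqDl_addq : left_distributive mulq addq.
Proof.
move=> p q r; rewrite -(rs_reprK p) -(rs_reprK q) -(rs_reprK r).
by rewrite !(addqE, mulqE); apply/rs_classP; exact: rs_mulD.
Qed.

Let mulqDl : left_distributive mulq +%R := mulqDl_addq.

HB.instance Definition _ := GRing.Zmodule_isComPzRing.Build rs_quot
  mulqA mulqC mul1q mulqDl.

Lemma rs_class0 : rs_class (rs_zero E) = 0. Proof. by []. Qed.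
Lemma rs_class1 : rs_class (rs_one E) = 1. Proof. by []. Qed.
Lemma rs_classN a : rs_class (rs_opp a) = - rs_class a.
Proof. exact/esym/oppqE. Qed.
Lemma rs_classD a b : rs_class (rs_add a b) = rs_class a + rs_class b.
Proof. exact/esym/addqE. Qed.
Lemma rs_classM a b : rs_class (rs_mul a b) = rs_class a * rs_class b.
Proof. exact/esym/mulqE. Qed.

End RingSetoidQuotient.

Record ideal (A : comPzRingType) := Ideal {
  iset :> set A;
  ideal0 : iset 0;
  idealD : forall a b, iset a -> iset b -> iset (a + b);
  idealMl : forall a b, iset b -> iset (a * b)
}.

Definition prime_ideal (A : comPzRingType) (I : ideal A) :=
  ~ iset I 1 /\ forall a b, iset I (a * b) -> iset I a \/ iset I b.

Definition maximal_ideal (A : comPzRingType) (I : ideal A) :=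
  ~ iset I 1 /\
  forall J : ideal A, I `<=` J -> ~ iset J 1 -> J `<=` I.

Section QuotientRing.
Variables (A : comPzRingType) (I : ideal A).

Lemma idealN a : iset I a -> iset I (- a).
Proof. by move=> Ia; rewrite -mulN1r; exact: idealMl. Qed.

Lemma idealB a b : iset I a -> iset I b -> iset I (a - b).
Proof. by move=> Ia Ib; apply: idealD => //; exact: idealN. Qed.

Definition quot_setoid : ring_setoid.
Proof.
refine (@RingSetoid A (fun a b => iset I (a - b)) 0 1 -%R +%R *%R
  _ _ _ _ _ _ _ _ _ _ _ _ _ _).
- by move=> a; rewrite subrr; exact: ideal0.
- by move=> a b /idealN; rewrite opprB.
- by move=> a b c ab bc; move: (idealD ab bc); rewrite addrA subrK.
- by move=> a a' /idealN; rewrite opprD.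
- move=> a a' b b' aa' bb'; move: (idealD aa' bb').
  by rewrite addrACA -opprD.
- move=> a a' b b' aa' bb'.
  rewrite (_ : a * b - a' * b' = b * (a - a') + a' * (b - b')).
    by apply: idealD; exact: idealMl.
  by rewrite !mulrBr (mulrC b a) (mulrC b a') addrA subrK.
- by move=> a b c; rewrite (addrA a b c) subrr; exact: ideal0.
- by move=> a b; rewrite (addrC a b) subrr; exact: ideal0.
- by move=> *; rewrite add0r subrr; exact: ideal0.
- by move=> *; rewrite addNr subrr; exact: ideal0.
- by move=> a b c; rewrite mulrA subrr; exact: ideal0.
- by move=> a b; rewrite (mulrC a b) subrr; exact: ideal0.
- by move=> *; rewrite mul1r subrr; exact: ideal0.
- by move=> *; rewrite mulrDl subrr; exact: ideal0.
Defined.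

Definition quot_ring : comPzRingType := rs_quot quot_setoid.
Definition quot_class (a : A) : quot_ring := @rs_class quot_setoid a.

End QuotientRing.

Record opens (X : topologicalType) := Opens {
  oset :> set X;
  osetP : open oset
}.

Definition opensT (X : topologicalType) : opens X := Opens (@openT X).

Definition opensI (X : topologicalType) (U V : opens X) : opens X :=
  Opens (openI (osetP U) (osetP V)).

Definition preim_opens (X Y : topologicalType) (f : X -> Y)
    (cf : continuous f) (V : opens Y) : opens X :=
  @Opens X (f @^-1` V) ((continuousP f).1 cf V (osetP V)).

Record presheaf (X : topologicalType) := Presheaf {
  sect :> opens X -> comPzRingType;
  restr : forall U V : opens X, V `<=` U -> {rmorphism sect U -> sect V};
  restr_id : forall (U : opens X) (UU : U `<=` U) s, restr UU s = s;
  restr_comp : forall (U V W : opens X) (VU : V `<=` U) (WV : W `<=` V)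
    (WU : W `<=` U) s, restr WV (restr VU s) = restr WU s
}.

Definition is_sheaf (X : topologicalType) (F : presheaf X) :=
  forall (U : opens X) (I : Type) (V : I -> opens X)
    (VU : forall i, V i `<=` U), U `<=` \bigcup_i V i ->
  forall s : forall i, F (V i),
    (forall i j, restr F (V := opensI (V i) (V j)) (@subIsetl _ _ _) (s i) =
                 restr F (V := opensI (V i) (V j)) (@subIsetr _ _ _) (s j)) ->
  exists! t : F U, forall i, restr F (VU i) t = s i.

Record ringed_space := RingedSpace {
  rspace :> topologicalType;
  rsheaf : presheaf rspace;
  rsheafP : is_sheaf rsheaf
}.

Definition ringed_space_iso (X Y : ringed_space) : Prop :=
  exists (f : X -> Y) (g : Y -> X) (cf : continuous f),
    [/\ continuous g, cancel f g & cancel g f] /\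
  exists phi : forall V : opens Y,
      {rmorphism rsheaf Y V -> rsheaf X (preim_opens cf V)},
    (forall V, bijective (phi V)) /\
    forall (V W : opens Y) (WV : W `<=` V) (s : rsheaf Y V),
      phi W (restr (rsheaf Y) WV s) =
      restr (rsheaf X) (U := preim_opens cf V) (V := preim_opens cf W)
        (preimage_subset WV) (phi V s).

Definition dsect (X : Type) (T : X -> Type) (U : set X) : Type :=
  forall x, U x -> T x.

Definition dres (X : Type) (T : X -> Type) (U V : set X) (VU : V `<=` U)
  (s : dsect T U) : dsect T V := fun x Vx => s x (VU x Vx).

Lemma dsectP (X : Type) (T : X -> Type) (U : set X) (s t : dsect T U) :
  (forall x Ux, s x Ux = t x Ux) -> s = t.
Proof.
move=> st; apply: functional_extensionality_dep => x.
by apply: functional_extensionality_dep => Ux.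
Qed.

Section DsectRing.
Variables (X : Type) (T : X -> comPzRingType) (U : set X).

HB.instance Definition _ := gen_eqMixin (dsect T U).
HB.instance Definition _ := gen_choiceMixin (dsect T U).

Let add (s t : dsect T U) : dsect T U := fun x Ux => s x Ux + t x Ux.
Let opp (s : dsect T U) : dsect T U := fun x Ux => - s x Ux.
Let zero : dsect T U := fun x Ux => 0.
Let one : dsect T U := fun x Ux => 1.
Let mul (s t : dsect T U) : dsect T U := fun x Ux => s x Ux * t x Ux.

Let addA : associative add.
Proof. by move=> s t u; apply: dsectP => x Ux; exact: addrA. Qed.
Let addC : commutative add.
Proof. by move=> s t; apply: dsectP => x Ux; exact: addrC. Qed.
Let add0 : left_id zero add.
Proof. by move=> s; apply: dsectP => x Ux; exact: add0r. Qed.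
Let addN : left_inverse zero opp add.
Proof. by move=> s; apply: dsectP => x Ux; exact: addNr. Qed.

HB.instance Definition _ := GRing.isZmodule.Build (dsect T U)
  addA addC add0 addN.

Let mulA : associative mul.
Proof. by move=> s t u; apply: dsectP => x Ux; exact: mulrA. Qed.
Let mulC : commutative mul.
Proof. by move=> s t; apply: dsectP => x Ux; exact: mulrC. Qed.
Let mul1 : left_id one mul.
Proof. by move=> s; apply: dsectP => x Ux; exact: mul1r. Qed.
Let mulD : left_distributive mul +%R.
Proof. by move=> s t u; apply: dsectP => x Ux; exact: mulrDl. Qed.

HB.instance Definition _ := GRing.Zmodule_isComPzRing.Build (dsect T U)
  mulA mulC mul1 mulD.

End DsectRing.

Lemma dsect_irr (X : Type) (T : X -> Type) (U : set X) (s : dsect T U) x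
  (h k : U x) : s x h = s x k.
Proof. by rewrite (Prop_irrelevance h k). Qed.

Record local_condition (X : topologicalType) (T : X -> comPzRingType) :=
  LocalCondition {
  lc : forall V : opens X, dsect T V -> Prop;
  lc1 : forall V : opens X, lc (1 : dsect T V);
  lcB : forall (V : opens X) (s t : dsect T V), lc s -> lc t -> lc (s - t);
  lcM : forall (V : opens X) (s t : dsect T V), lc s -> lc t -> lc (s * t);
  lc_res : forall (U V : opens X) (VU : V `<=` U) (s : dsect T U),
    lc s -> lc (dres VU s)
}.

Section LocalSheaf.
Variables (X : topologicalType) (T : X -> comPzRingType).
Variable P : local_condition T.

Definition locally_lc (U : opens X) (s : dsect T U) :=
  forall x, oset U x ->
    exists (V : opens X) (VU : V `<=` U), oset V x /\ lc P (dres VU s).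

Definition locally_lcb (U : opens X) : pred (dsect T U) :=
  fun s => `[< locally_lc s >].

Definition local_sect (U : opens X) := {s : dsect T U | locally_lcb s}.
HB.instance Definition _ U := SubChoice.on (local_sect U).

Lemma local_sect_closed U : subring_closed (@locally_lcb U).
Proof.
split.
- apply/asboolP => x Ux; exists U, (@subset_refl _ _); split=> //.
  exact: (lc1 P U).
- move=> s t /asboolP sP /asboolP tP; apply/asboolP => x Ux.
  have [V [VU [Vx sV]]] := sP x Ux; have [W [WU [Wx tW]]] := tP x Ux.
  exists (opensI V W), (subset_trans (@subIsetl _ V W) VU); split=> //.
  have := lcB (lc_res (V := opensI V W) (@subIsetl _ V W) sV)
              (lc_res (V := opensI V W) (@subIsetr _ V W) tW).
  congr (lc P _); apply: dsectP => y Vy; rewrite /dres.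
  by congr (s y _ - t y _); exact: Prop_irrelevance.
- move=> s t /asboolP sP /asboolP tP; apply/asboolP => x Ux.
  have [V [VU [Vx sV]]] := sP x Ux; have [W [WU [Wx tW]]] := tP x Ux.
  exists (opensI V W), (subset_trans (@subIsetl _ V W) VU); split=> //.
  have := lcM (lc_res (V := opensI V W) (@subIsetl _ V W) sV)
              (lc_res (V := opensI V W) (@subIsetr _ V W) tW).
  congr (lc P _); apply: dsectP => y Vy; rewrite /dres.
  by congr (s y _ * t y _); exact: Prop_irrelevance.
Qed.

HB.instance Definition _ U := GRing.SubChoice_isSubComPzRing.Build _ _
  (local_sect U) (@local_sect_closed U).

Lemma local_res_subproof (U V : opens X) (VU : V `<=` U) (s : local_sect U) :
  locally_lcb (dres VU (val s)).
Proof.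
apply/asboolP => x Vx; have /asboolP /(_ x (VU x Vx)) := valP s.
move=> [W [WU [Wx sW]]].
exists (opensI W V), (@subIsetr _ W V); split=> //.
have := lc_res (V := opensI W V) (@subIsetl _ W V) sW.
congr (lc P _); apply: dsectP => y Wy; rewrite /dres.
exact: (dsect_irr (val s)).
Qed.

Definition local_res (U V : opens X) (VU : V `<=` U) (s : local_sect U) :
  local_sect V := exist _ (dres VU (val s)) (local_res_subproof VU s).

Lemma local_res_zmod U V (VU : oset V `<=` oset U) :
  zmod_morphism (local_res VU).
Proof. by move=> s t; apply: val_inj. Qed.

Lemma local_res_monoid U V (VU : oset V `<=` oset U) :
  monoid_morphism (local_res VU).
Proof. by split=> [|s t]; apply: val_inj. Qed.

HB.instance Definition _ U V VU := GRing.isZmodMorphism.Build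
  (local_sect U) (local_sect V) (local_res VU) (local_res_zmod VU).
HB.instance Definition _ U V VU := GRing.isMonoidMorphism.Build
  (local_sect U) (local_sect V) (local_res VU) (local_res_monoid VU).

Definition local_presheaf : presheaf X.
Proof.
refine (@Presheaf X (fun U => local_sect U : comPzRingType)
  (fun U V VU => local_res VU : {rmorphism _ -> _}) _ _).
- move=> U UU s; apply: val_inj; apply: dsectP => x Ux /=.
  exact: (dsect_irr (val s)).
- move=> U V W VU WV WU s; apply: val_inj; apply: dsectP => x Wx /=.
  exact: (dsect_irr (val s)).
Defined.

Lemma local_presheaf_sheaf : is_sheaf local_presheaf.
Proof.
move=> U I V VU cU s comp.
have compE i j x (Vix : oset (V i) x) (Vjx : oset (V j) x) :
    val (s i) x Vix = val (s j) x Vjx.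
  have := congr1 (fun t : local_sect (opensI (V i) (V j)) =>
    val t x (conj Vix Vjx)) (comp i j).
  move=> eij; exact: etrans (dsect_irr (val (s i)) _ _)
    (etrans eij (dsect_irr (val (s j)) _ _)).
have ci x (Ux : oset U x) : exists i, oset (V i) x.
  by have [i _ ?] := cU x Ux; exists i.
pose t0 : dsect T U := fun x Ux =>
  val (s (projT1 (cid (ci x Ux)))) x (projT2 (cid (ci x Ux))).
have t0E i x (Ux : oset U x) (Vix : oset (V i) x) :
  t0 x Ux = val (s i) x Vix by exact: compE.
have t0P : locally_lcb t0.
  apply/asboolP => x Ux; have [i Vix] := ci x Ux.
  have /asboolP /(_ x Vix) [W [WV [Wx sW]]] := valP (s i).
  exists W, (subset_trans WV (VU i)); split=> //.
  rewrite (_ : dres _ t0 = dres WV (val (s i)))//.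
  by apply: dsectP => y Wy; exact: t0E.
exists (exist _ t0 t0P : local_sect U); split.
  by move=> i; apply: val_inj; apply: dsectP => x Vix; exact: t0E.
move=> t tE; apply: val_inj; apply: dsectP => x Ux /=.
have [i Vix] := ci x Ux; rewrite (t0E i x Ux Vix) -(tE i).
exact: (dsect_irr (val t)).
Qed.

End LocalSheaf.

Section Stalk.
Variables (X : topologicalType) (F : presheaf X) (x : X).

Record pregerm := Pregerm {
  pg_dom : opens X;
  pg_mem : oset pg_dom x;
  pg_sect : F pg_dom
}.

Definition pregerm_eq (a b : pregerm) :=
  exists (W : opens X) (Wa : W `<=` pg_dom a) (Wb : W `<=` pg_dom b),
    oset W x /\ restr F Wa (pg_sect a) = restr F Wb (pg_sect b).

Definition pregerm_op (op : forall U, F U -> F U -> F U) (a b : pregerm) :=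
  @Pregerm (opensI (pg_dom a) (pg_dom b)) (conj (pg_mem a) (pg_mem b))
    (op _ (restr F (V := opensI _ _) (@subIsetl _ _ _) (pg_sect a))
          (restr F (V := opensI _ _) (@subIsetr _ _ _) (pg_sect b))).

Lemma restrE (U V W : opens X) (VU : V `<=` U) (WV : W `<=` V) s :
  restr F WV (restr F VU s) = restr F (subset_trans WV VU) s.
Proof. exact: restr_comp. Qed.

Lemma restr_irr (U V : opens X) (h k : V `<=` U) s :
  restr F h s = restr F k s.
Proof. by rewrite (Prop_irrelevance h k). Qed.

Lemma pregerm_op_eq (op : forall U, F U -> F U -> F U) :
  (forall (U V : opens X) (VU : V `<=` U) s t,
    restr F VU (op U s t) = op V (restr F VU s) (restr F VU t)) ->
  forall a a' b b', pregerm_eq a a' -> pregerm_eq b b' ->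
    pregerm_eq (pregerm_op op a b) (pregerm_op op a' b').
Proof.
move=> opE a a' b b' [W [Wa [Wa' [Wx aa']]]] [V [Vb [Vb' [Vx bb']]]].
exists (opensI W V), (setISS Wa Vb), (setISS Wa' Vb'); split=> //=.
rewrite !opE !restrE; congr (op _ _ _).
  have := congr1 (restr F (V := opensI W V) (@subIsetl _ _ _)) aa'.
  rewrite !restrE => e.
  exact: etrans (restr_irr _ _ _) (etrans e (restr_irr _ _ _)).
have := congr1 (restr F (V := opensI W V) (@subIsetr _ _ _)) bb'.
rewrite !restrE => e.
  exact: etrans (restr_irr _ _ _) (etrans e (restr_irr _ _ _)).
Qed.

Definition stalk_setoid : ring_setoid.
Proof.
refine (@RingSetoid pregerm pregerm_eq
  (@Pregerm (opensT X) I 0) (@Pregerm (opensT X) I 1)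
  (fun a => Pregerm (pg_mem a) (- pg_sect a))
  (pregerm_op (fun U => +%R)) (pregerm_op (fun U => *%R))
  _ _ _ _ _ _ _ _ _ _ _ _ _ _).
- move=> a; exists (pg_dom a), (@subset_refl _ _), (@subset_refl _ _).
  by split=> //; exact: pg_mem.
- by move=> a b [W [Wa [Wb [Wx ab]]]]; exists W, Wb, Wa.
- move=> a b c [W [Wa [Wb [Wx ab]]]] [V [Vb [Vc [Vx bc]]]].
  exists (opensI W V), (subset_trans (@subIsetl _ _ _) Wa),
    (subset_trans (@subIsetr _ _ _) Vc); split=> //.
  rewrite -!restrE ab -bc !restrE; exact: restr_irr.
- move=> a b [W [Wa [Wb [Wx ab]]]]; exists W, Wa, Wb; split=> //=.
  by rewrite !rmorphN ab.
- by apply: pregerm_op_eq => U V VU s t; rewrite rmorphD.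
- by apply: pregerm_op_eq => U V VU s t; rewrite rmorphM.
- move=> [U Ux s] [V Vx t] [W Wx u].
  have h : opensI U (opensI V W) `<=` opensI (opensI U V) W.
    by move=> y [? []].
  exists (opensI U (opensI V W)), (@subset_refl _ _), h; split=> //=.
  rewrite !rmorphD /= !restrE addrA.
  by congr (_ + _ + _); exact: restr_irr.
- move=> [U Ux s] [V Vx t].
  have h : opensI U V `<=` opensI V U by move=> y [].
  exists (opensI U V), (@subset_refl _ _), h; split=> //=.
  rewrite !rmorphD /= !restrE addrC.
  by congr (_ + _); exact: restr_irr.
- move=> [U Ux s]; have h : U `<=` opensI (opensT X) U by [].
  exists U, h, (@subset_refl _ _); split=> //=.
  by rewrite rmorphD /= !restrE rmorph0 add0r; exact: restr_irr.
- move=> [U Ux s]; have h : opensI U U `<=` opensT X by [].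
  exists (opensI U U), (@subset_refl _ _), h; split=> //=.
  rewrite rmorphD /= !restrE rmorphN rmorph0; apply/eqP.
  by rewrite addrC subr_eq0; apply/eqP; exact: restr_irr.
- move=> [U Ux s] [V Vx t] [W Wx u].
  have h : opensI U (opensI V W) `<=` opensI (opensI U V) W.
    by move=> y [? []].
  exists (opensI U (opensI V W)), (@subset_refl _ _), h; split=> //=.
  rewrite !rmorphM /= !restrE mulrA.
  by congr (_ * _ * _); exact: restr_irr.
- move=> [U Ux s] [V Vx t].
  have h : opensI U V `<=` opensI V U by move=> y [].
  exists (opensI U V), (@subset_refl _ _), h; split=> //=.
  rewrite !rmorphM /= !restrE mulrC.
  by congr (_ * _); exact: restr_irr.
- move=> [U Ux s]; have h : U `<=` opensI (opensT X) U by [].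
  exists U, h, (@subset_refl _ _); split=> //=.
  by rewrite rmorphM /= !restrE rmorph1 mul1r; exact: restr_irr.
- move=> [U Ux s] [V Vx t] [W Wx u].
  have h : opensI (opensI U V) W `<=` opensI (opensI U W) (opensI V W).
    by move=> y [[]].
  exists (opensI (opensI U V) W), (@subset_refl _ _), h; split=> //=.
  rewrite !(rmorphD, rmorphM) /= !restrE mulrDl.
  by congr (_ * _ + _ * _); exact: restr_irr.
Defined.

Definition stalk : comPzRingType := rs_quot stalk_setoid.

Definition germ (U : opens X) (Ux : oset U x) (s : F U) : stalk :=
  @rs_class stalk_setoid (Pregerm Ux s).

Lemma germP (U V : opens X) (Ux : oset U x) (Vx : oset V x)
    (s : F U) (t : F V) :
  germ Ux s = germ Vx t <->
  exists (W : opens X) (WU : W `<=` U) (WV : W `<=` V),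
    oset W x /\ restr F WU s = restr F WV t.
Proof. exact: rs_classP. Qed.

Lemma germ_res (U V : opens X) (VU : V `<=` U) (Ux : oset U x)
  (Vx : oset V x) (s : F U) : germ Vx (restr F VU s) = germ Ux s.
Proof.
apply/germP; exists V, (@subset_refl _ _), VU; split=> //.
by rewrite restrE; exact: restr_irr.
Qed.

Lemma germ1 (U : opens X) (Ux : oset U x) : germ Ux 1 = 1.
Proof.
apply/rs_classP; exists U, (@subset_refl _ _), (@subsetT _ _); split=> //=.
by rewrite !rmorph1.
Qed.

Lemma germB (U : opens X) (Ux : oset U x) (s t : F U) :
  germ Ux (s - t) = germ Ux s - germ Ux t.
Proof.
transitivity (@rs_class stalk_setoid (@rs_add stalk_setoid (Pregerm Ux s)
  (@rs_opp stalk_setoid (Pregerm Ux t)))); last by rewrite rs_classD rs_classN.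
apply/rs_classP; exists U, (@subset_refl _ _), (fun y Uy => conj Uy Uy).
split=> //=; rewrite !rmorphD /= !restrE !rmorphN.
by congr (_ - _); exact: restr_irr.
Qed.

Lemma germM (U : opens X) (Ux : oset U x) (s t : F U) :
  germ Ux (s * t) = germ Ux s * germ Ux t.
Proof.
transitivity (@rs_class stalk_setoid (@rs_mul stalk_setoid (Pregerm Ux s)
  (Pregerm Ux t))); last by rewrite rs_classM.
apply/rs_classP; exists U, (@subset_refl _ _), (fun y Uy => conj Uy Uy).
split=> //=; rewrite !rmorphM /= !restrE.
by congr (_ * _); exact: restr_irr.
Qed.

End Stalk.

(* The inverse image sheaf f^-1 F, i.e. the sheafification of the presheaf
   U |-> colim_{W open, f(U) included in W} F(W).  The stalk of that presheaf
   at x is F_{f(x)}, hence a section over U of its sheafification is a family of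
   germs s(x) in F_{f(x)}, x in U, that is locally the family of germs of one
   section of F over an open set W whose preimage contains the points at hand. *)

Section InverseImage.
Variables (X Y : topologicalType) (f : X -> Y) (F : presheaf Y).

Definition inverse_image_cond (V : opens X)
    (s : dsect (fun x => stalk F (f x)) V) : Prop :=
  exists (W : opens Y) (t : F W) (VW : V `<=` f @^-1` W),
    forall x (Vx : oset V x), s x Vx = germ (VW x Vx : oset W (f x)) t.

Definition inverse_image_lc : local_condition (fun x => stalk F (f x)).
Proof.
refine (@LocalCondition _ _ inverse_image_cond _ _ _ _).
- move=> V; exists (opensT Y), 1, (fun _ _ => I).
  by move=> x Vx; apply/esym; exact: germ1.
- move=> V s t [W [u [VW sE]]] [W' [u' [VW' tE]]].
  exists (opensI W W'),
    (restr F (V := opensI W W') (@subIsetl _ _ _) u -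
     restr F (V := opensI W W') (@subIsetr _ _ _) u'),
    (fun x Vx => conj (VW x Vx) (VW' x Vx)).
  move=> x Vx.
  by rewrite germB !(germ_res _ (VW x Vx)) !(germ_res _ (VW' x Vx)) -sE -tE.
- move=> V s t [W [u [VW sE]]] [W' [u' [VW' tE]]].
  exists (opensI W W'),
    (restr F (V := opensI W W') (@subIsetl _ _ _) u *
     restr F (V := opensI W W') (@subIsetr _ _ _) u'),
    (fun x Vx => conj (VW x Vx) (VW' x Vx)).
  move=> x Vx.
  by rewrite germM !(germ_res _ (VW x Vx)) !(germ_res _ (VW' x Vx)) -sE -tE.
- move=> U V VU s [W [u [UW sE]]].
  exists W, u, (fun x Vx => UW x (VU x Vx)) => x Vx; exact: sE.
Defined.

Definition inverse_image : presheaf X := local_presheaf inverse_image_lc.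

Definition inverse_image_space : ringed_space :=
  RingedSpace (@local_presheaf_sheaf _ _ inverse_image_lc).

End InverseImage.

Record spec (A : comPzRingType) := Spec {
  spec_ideal :> ideal A;
  spec_prime : prime_ideal spec_ideal
}.

Section Zariski.
Variable A : comPzRingType.

HB.instance Definition _ := gen_eqMixin (spec A).
HB.instance Definition _ := gen_choiceMixin (spec A).

Definition zariski_closed (E : set A) : set (spec A) :=
  [set p : spec A | E `<=` p].

Definition zariski_open : set_system (spec A) :=
  [set ~` zariski_closed E | E in setT].

Let zariski_openT : zariski_open setT.
Proof.
exists setT => //; apply/seteqP; split=> // p _ /= Ep.
by have [+ _] := spec_prime p; apply; exact: Ep.
Qed.

Let zariski_openI : setI_closed zariski_open.
Proof.
move=> _ _ [E _ <-] [E' _ <-].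
exists [set a * b | a in E & b in E'] => //.
rewrite -setCU; congr (~` _); apply/seteqP; split=> p /=.
  move=> EE'; apply: contrapT => /not_orP[].
  move=> /existsNP[a /not_implyP[Ea pa]] /existsNP[b /not_implyP[Eb pb]].
  have [_ pp] := spec_prime p.
  have : iset p (a * b) by apply: EE'; exists a => //; exists b.
  by case/pp.
move=> [Ep|Ep] _ [a Ea [b Eb <-]].
  by rewrite mulrC; apply: idealMl; exact: Ep.
by apply: idealMl; exact: Ep.
Qed.

Let zariski_open_bigU (I : Type) (f : I -> set (spec A)) :
  (forall i, zariski_open (f i)) -> zariski_open (\bigcup_i f i).
Proof.
move=> fo; pose E i := s2val (cid2 (fo i)).
have fE i : ~` zariski_closed (E i) = f i := s2valP' (cid2 (fo i)).
exists (\bigcup_i E i) => //.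
apply/seteqP; split=> p /=.
  move=> /existsNP[a /not_implyP[[i _ Eia] pa]]; exists i => //.
  by rewrite -fE => Ep; apply: pa; exact: Ep.
move=> [i _]; rewrite -fE => nEp Ep; apply: nEp => a Ea.
by apply: Ep; exists i.
Qed.

HB.instance Definition _ := isOpenTopological.Build (spec A)
  zariski_openT zariski_openI zariski_open_bigU.

End Zariski.

Section Localization.
Variables (A : comPzRingType) (p : spec A).

Record frac_pair := FracPair {
  fnum : A;
  fden : A;
  fdenP : ~ iset p fden
}.

Lemma spec1 : ~ iset p 1.
Proof. by have [] := spec_prime p. Qed.

Lemma specM a b : ~ iset p a -> ~ iset p b -> ~ iset p (a * b).
Proof. by have [_ pp] := spec_prime p; move=> pa pb /pp[]. Qed.

Definition frac_eq (a b : frac_pair) :=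
  exists2 u, ~ iset p u & u * (fnum a * fden b) = u * (fnum b * fden a).

Definition loc_setoid : ring_setoid.
Proof.
refine (@RingSetoid frac_pair frac_eq (FracPair 0 spec1) (FracPair 1 spec1)
  (fun a => FracPair (- fnum a) (@fdenP a))
  (fun a b => FracPair (fnum a * fden b + fnum b * fden a)
                (specM (@fdenP a) (@fdenP b)))
  (fun a b => FracPair (fnum a * fnum b) (specM (@fdenP a) (@fdenP b)))
  _ _ _ _ _ _ _ _ _ _ _ _ _ _).
- by move=> a; exists 1; first exact: spec1.
- by move=> a b [u pu ab]; exists u.
- move=> a b c [u pu ab] [v pv bc]; exists (u * v * fden b).
    by apply: specM; [exact: specM | exact: fdenP].
  transitivity ((u * (fnum a * fden b)) * (v * fden c)); first by ring.
  rewrite ab; transitivity ((v * (fnum b * fden c)) * (u * fden a)).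
    by ring.
  by rewrite bc; ring.
- move=> a b [u pu ab]; exists u => //=.
  by rewrite !mulNr !mulrN ab.
- move=> a a' b b' [u pu aa'] [v pv bb']; exists (u * v) => /=.
    exact: specM.
  transitivity ((u * (fnum a * fden a')) * (v * fden b * fden b') +
                (v * (fnum b * fden b')) * (u * fden a * fden a')); first by ring.
  by rewrite aa' bb'; ring.
- move=> a a' b b' [u pu aa'] [v pv bb']; exists (u * v) => /=.
    exact: specM.
  transitivity ((u * (fnum a * fden a')) * (v * (fnum b * fden b'))).
    by ring.
  by rewrite aa' bb'; ring.
- by move=> a b c; exists 1 => /=; [exact: spec1 | ring].
- by move=> a b; exists 1 => /=; [exact: spec1 | ring].
- by move=> a; exists 1 => /=; [exact: spec1 | ring].
- by move=> a; exists 1 => /=; [exact: spec1 | ring].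
- by move=> a b c; exists 1 => /=; [exact: spec1 | ring].
- by move=> a b; exists 1 => /=; [exact: spec1 | ring].
- by move=> a; exists 1 => /=; [exact: spec1 | ring].
- by move=> a b c; exists 1 => /=; [exact: spec1 | ring].
Defined.

Definition localization : comPzRingType := rs_quot loc_setoid.

Definition frac (a f : A) (pf : ~ iset p f) : localization :=
  @rs_class loc_setoid (FracPair a pf).

Lemma fracP a f a' f' (pf : ~ iset p f) (pf' : ~ iset p f') :
  frac a pf = frac a' pf' <->
  exists2 u, ~ iset p u & u * (a * f') = u * (a' * f).
Proof. exact: rs_classP. Qed.

Lemma frac1 : frac 1 spec1 = 1. Proof. by []. Qed.

Lemma fracB a f a' f' (pf : ~ iset p f) (pf' : ~ iset p f') :
  frac a pf - frac a' pf' = frac (a * f' - a' * f) (specM pf pf').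
Proof. by rewrite -mulNr -rs_classN -rs_classD. Qed.

Lemma fracM a f a' f' (pf : ~ iset p f) (pf' : ~ iset p f') :
  frac a pf * frac a' pf' = frac (a * a') (specM pf pf').
Proof. by rewrite -rs_classM. Qed.

End Localization.

Section AffineScheme.
Variable A : comPzRingType.

Definition spec_cond (V : opens (spec A))
    (s : dsect (fun p : spec A => localization p) V) : Prop :=
  exists a f : A, forall p (Vp : oset V p),
    exists pf : ~ iset p f, s p Vp = frac a pf.

Definition spec_lc :
  local_condition (fun p : spec A => localization p).
Proof.
refine (@LocalCondition _ _ spec_cond _ _ _ _).
- by move=> V; exists 1, 1 => p Vp; exists (@spec1 _ p).
- move=> V s t [a [f sE]] [a' [f' tE]].
  exists (a * f' - a' * f), (f * f') => p Vp.
  have [pf spE] := sE p Vp; have [pf' tpE] := tE p Vp.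
  exists (specM pf pf'); rewrite -fracB -spE -tpE; by [].
- move=> V s t [a [f sE]] [a' [f' tE]]; exists (a * a'), (f * f') => p Vp.
  have [pf spE] := sE p Vp; have [pf' tpE] := tE p Vp.
  exists (specM pf pf'); rewrite -fracM -spE -tpE; by [].
- by move=> U V VU s [a [f sE]]; exists a, f => p Vp; exact: sE.
Defined.

Definition affine_scheme : ringed_space :=
  RingedSpace (@local_presheaf_sheaf _ _ spec_lc).

End AffineScheme.

Section RealSpectrum.
Variables (R : realType) (A : comPzRingType) (alg : {rmorphism R -> A}).

(* alg is the structure morphism of the R-algebra A. *)
Definition real_spec : set (spec A) :=
  [set m : spec A | maximal_ideal m /\
    exists phi : {rmorphism quot_ring m -> R},
      bijective phi /\ forall r : R, phi (quot_class m (alg r)) = r].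

Definition real_affine_space : ringed_space :=
  inverse_image_space (set_val : real_spec -> spec A)
    (rsheaf (affine_scheme A)).

End RealSpectrum.

Section Smooth.
Variables (R : realType) (n : nat).

Definition iter_partial (s : seq 'I_n) (g : 'rV[R]_n -> R) : 'rV[R]_n -> R :=
  foldr (fun i h => 'D_('e_i : 'rV[R]_n) h) g s.

(* For open U: all iterated partial derivatives of g exist and are continuous
   on U. *)
Definition smooth_on (U : set 'rV[R]_n) (g : 'rV[R]_n -> R) :=
  forall (s : seq 'I_n) (x : 'rV[R]_n), U x ->
    {for x, continuous (iter_partial s g)} /\
    forall i : 'I_n, derivable (iter_partial s g) x ('e_i : 'rV[R]_n).

End Smooth.

Section Manifolds.
Variables (R : realType) (M : topologicalType) (k : nat).

(* A homeomorphism of the open subset cdom of M onto an open subset of R^k,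
   with inverse cinv; the values of cmap and cinv elsewhere are irrelevant. *)
Record chart := Chart {
  cdom : set M;
  cmap : M -> 'rV[R]_k;
  cinv : 'rV[R]_k -> M;
  cdom_open : open cdom;
  cmap_open : open (cmap @` cdom);
  cmapK : forall x, cdom x -> cinv (cmap x) = x;
  cmap_cont : forall x, cdom x -> {for x, continuous cmap};
  cinv_cont : forall x, cdom x -> {for cmap x, continuous cinv}
}.

Definition smooth_atlas (A : set chart) :=
  (forall x, exists2 c, A c & cdom c x) /\
  forall c d, A c -> A d -> forall i : 'I_k,
    smooth_on (cmap c @` (cdom c `&` cdom d))
      (fun v => cmap d (cinv c v) 0 i).

Definition smooth_manifold (A : set chart) :=
  [/\ hausdorff_space M, @second_countable M & smooth_atlas A].

Definition smooth_functions (A : set chart) : set (M -> R) :=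
  [set f : M -> R | forall c, A c -> smooth_on (cmap c @` cdom c) (f \o cinv c)].

End Manifolds.

Section FunctionGerms.
Variables (R : realType) (X : topologicalType) (x : X).

Definition vanishing_near : ideal (X -> R).
Proof.
refine (@Ideal (X -> R) [set f : X -> R | \forall y \near x, f y = 0] _ _ _) => /=.
- by near=> y.
- move=> f g fx gx; near=> y; rewrite fctE/= (near fx y)// (near gx y)//.
  by rewrite addr0.
- by move=> f g gx; near=> y; rewrite fctE/= (near gx y)// mulr0.
Unshelve. all: by end_near. Defined.

Definition all_germs : comPzRingType := quot_ring vanishing_near.
Definition fgerm (f : X -> R) : all_germs := quot_class vanishing_near f.
Definition fgerm_repr (g : all_germs) : X -> R := rs_repr g.

Lemma fgermP (f g : X -> R) :
  fgerm f = fgerm g <-> \forall y \near x, f y = g y.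
Proof.
rewrite rs_classP /=; split=> h; near=> y.
  by apply/eqP; rewrite -subr_eq0; apply/eqP; exact: (near h y).
by rewrite !fctE/= (near h y)// subrr.
Unshelve. all: by end_near. Qed.

Lemma fgerm1 : fgerm 1 = 1.
Proof. exact: rs_class1. Qed.

Lemma fgermB (f g : X -> R) : fgerm (f - g) = fgerm f - fgerm g.
Proof. by rewrite -rs_classN -rs_classD. Qed.

Lemma fgermM (f g : X -> R) : fgerm (f * g) = fgerm f * fgerm g.
Proof. by rewrite -rs_classM. Qed.

Lemma fgerm_reprK (g : all_germs) : fgerm (fgerm_repr g) = g.
Proof. exact: rs_reprK. Qed.

(* Independent of the representative, see `germ_evalE`. *)
Definition germ_eval (g : all_germs) : R := fgerm_repr g x.

Lemma germ_evalE f : germ_eval (fgerm f) = f x.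
Proof.
have /fgermP := fgerm_reprK (fgerm f); exact: nbhs_singleton.
Qed.

Definition germs_of (C : set (X -> R)) : set all_germs := fgerm @` C.

End FunctionGerms.

Arguments germs_of {R X} x C.
Arguments fgerm {R X} x f.
Arguments germ_eval {R X x} g.

Section GermPullback.
Variables (R : realType) (X Y : topologicalType) (h : X -> Y) (x : X).

(* Computed on a representative; `germ_pullbackE` shows that it is well defined
   for continuous h. *)
Definition germ_pullback (g : all_germs R (h x)) : all_germs R x :=
  fgerm x (fgerm_repr g \o h).

Lemma germ_pullbackE (f : Y -> R) : {for x, continuous h} ->
  germ_pullback (fgerm (h x) f) = fgerm x (f \o h).
Proof.
have /fgermP fE := fgerm_reprK (fgerm (h x) f).
by move=> ch; apply/fgermP; exact: ch fE.
Qed.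

End GermPullback.

Record differential_space (R : realType) := DifferentialSpace {
  dspace :> topologicalType;
  dfun : set (dspace -> R);
  dfun_continuous : forall f, dfun f -> continuous f;
  dfun1 : dfun 1;
  dfunD : forall f g, dfun f -> dfun g -> dfun (f + g);
  dfunM : forall f g, dfun f -> dfun g -> dfun (f * g);
  dfunZ : forall (r : R) f, dfun f -> dfun (r *: f);
  dfun_local : forall f : dspace -> R, dfun f <->
    forall x, exists (U : set dspace) (g : dspace -> R),
      [/\ open U, U x, dfun g & forall y, U y -> f y = g y];
  dfun_smooth : forall (n : nat) (f : 'I_n -> dspace -> R)
      (g : 'rV[R]_n -> R), (0 < n)%N -> (forall i, dfun (f i)) ->
    smooth_on setT g -> dfun (fun x => g (\row_i f i x))
}.

Section StructureSheaf.
Variables (R : realType) (S : differential_space R).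

Lemma dfun_cst (r : R) : dfun (cst r : S -> R).
Proof.
have -> : (cst r : S -> R) = r *: (1 : S -> R).
  by apply/funext => x; rewrite !fctE/= [RHS]mulr1.
exact/dfunZ/dfun1.
Qed.

Lemma dfunB (f g : S -> R) : dfun f -> dfun g -> dfun (f - g).
Proof. by move=> Cf Cg; rewrite -scaleN1r; apply/dfunD/dfunZ. Qed.

(* The sections of the sheaf are the functions that locally satisfy this
   condition, i.e. the locally extendable ones; they are continuous. *)
Definition extendable_cond (V : opens S)
    (s : dsect (fun _ : S => R : comPzRingType) V) : Prop :=
  exists2 h, dfun h & forall x (Vx : oset V x), s x Vx = h x.

Definition extendable_lc :
  local_condition (fun _ : S => R : comPzRingType).
Proof.
refine (@LocalCondition _ _ extendable_cond _ _ _ _).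
- by move=> V; exists 1 => //; exact: dfun1.
- move=> V s t [f Cf sE] [g Cg tE]; exists (f - g); first exact: dfunB.
  by move=> x Vx; rewrite [RHS]/(f x - g x) -(sE x Vx) -(tE x Vx).
- move=> V s t [f Cf sE] [g Cg tE]; exists (f * g); first exact: dfunM.
  by move=> x Vx; rewrite [RHS]/(f x * g x) -(sE x Vx) -(tE x Vx).
- by move=> U V VU s [f Cf sE]; exists f => // x Vx; exact: sE.
Defined.

Definition structure_sheaf : presheaf S := local_presheaf extendable_lc.

Definition structure_space : ringed_space :=
  RingedSpace (@local_presheaf_sheaf _ _ extendable_lc).

Definition global_sections : comPzRingType := structure_sheaf (opensT S).

Definition const_sect (r : R) : dsect (fun _ : S => R : comPzRingType)
  (opensT S) := fun _ _ => r.

Lemma global_cst_subproof (r : R) : locally_lcb extendable_lc (const_sect r).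
Proof.
apply/asboolP => x Ux; exists (opensT S), (@subset_refl _ _); split=> //.
by exists (cst r); first exact: dfun_cst.
Qed.

Definition global_cst (r : R) : global_sections :=
  exist (fun s => locally_lcb extendable_lc s) (const_sect r)
    (global_cst_subproof r).

Lemma global_cst_zmod : zmod_morphism global_cst.
Proof. by move=> r t; apply: val_inj. Qed.

Lemma global_cst_monoid : monoid_morphism global_cst.
Proof. by split=> [|r t]; apply: val_inj. Qed.

HB.instance Definition _ := GRing.isZmodMorphism.Build
  R global_sections global_cst global_cst_zmod.
HB.instance Definition _ := GRing.isMonoidMorphism.Build
  R global_sections global_cst global_cst_monoid.

Definition global_alg : {rmorphism R -> global_sections} := global_cst.

End StructureSheaf.

Section Stratifold.
Variables (R : realType) (S : differential_space R).

Definition dgerms (x : S) : set (all_germs R x) := germs_of x (@dfun R S).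
Arguments dgerms : clear implicits.

Definition dgermsb (x : S) : pred (all_germs R x) :=
  fun g => `[< dgerms x g >].

Definition germ_algebra (x : S) := {g : all_germs R x | dgermsb g}.
HB.instance Definition _ x := SubChoice.on (germ_algebra x).

Lemma germ_algebra_closed x : subring_closed (@dgermsb x).
Proof.
split.
- by apply/asboolP; exists 1; [exact: dfun1 | exact: fgerm1].
- move=> _ _ /asboolP[f Cf <-] /asboolP[g Cg <-]; apply/asboolP.
  by exists (f - g); [exact: dfunB | rewrite -fgermB].
- move=> _ _ /asboolP[f Cf <-] /asboolP[g Cg <-]; apply/asboolP.
  by exists (f * g); [exact: dfunM | rewrite -fgermM].
Qed.

HB.instance Definition _ x := GRing.SubChoice_isSubComPzRing.Build _ _
  (germ_algebra x) (@germ_algebra_closed x).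

Lemma germ_cst_subproof (x : S) (r : R) : dgermsb (fgerm x (cst r)).
Proof. by apply/asboolP; exists (cst r) => //; exact: dfun_cst. Qed.

Definition germ_cst (x : S) (r : R) : germ_algebra x :=
  exist (fun g => dgermsb g) (fgerm x (cst r)) (germ_cst_subproof x r).

Definition tangent_space (x : S) : set (germ_algebra x -> R) :=
  [set D | [/\ forall a b : germ_algebra x, D (a + b) = D a + D b,
               forall (r : R) (a : germ_algebra x),
                 D (germ_cst x r * a) = r * D a &
               forall a b : germ_algebra x,
                 D (a * b) =
                 germ_eval (val a) * D b + germ_eval (val b) * D a]].
Arguments tangent_space : clear implicits.

Definition dim_le (V : lmodType R) (W : set V) (k : nat) :=
  exists2 v : 'I_k -> V, (forall i, W (v i)) &
    forall w, W w -> exists c : 'I_k -> R, w = \sum_i c i *: v i.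

Definition skeleton (k : nat) : set S :=
  [set x | dim_le (tangent_space x) k].

Definition stratum (k : nat) : set S :=
  if k is k'.+1 then skeleton k `\` skeleton k' else skeleton 0.

(* The restriction of germs is a ring morphism, so it is an isomorphism as soon
   as it is bijective. *)
Definition stratifold : Prop :=
  [/\ [/\ locally_compact [set: S], hausdorff_space S & @second_countable S],
      forall k, closed (skeleton k),
      forall (x : S) (U : set S), open U -> U x ->
        exists rho : S -> R, [/\ dfun rho, forall y, 0 <= rho y,
          rho x != 0 & closure [set y | rho y != 0] `<=` U],
      forall k, exists A : set (chart R (stratum k) k), smooth_manifold A /\
        forall x : stratum k,
          set_bij (dgerms (set_val x)) (germs_of x (smooth_functions A))
            (@germ_pullback R (stratum k) S set_val x) &
      exists n, skeleton n = setT].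

End Stratifold.

(* Main.v *)
(* A point x of S gives the ideal of the functions in C that vanish at x, and by
   the bump functions this map is a homeomorphism onto its image.  It is onto the
   real spectrum by Milnor's argument: C contains a function f whose fibres lie
   in compact sets.  Let chi be the character with kernel m.  The zero sets of
   the elements of m generate a filter, which is proper because a nowhere
   vanishing element of C is a unit, and which contains a compact set because
   f - chi(f) is in m; every element of m vanishes at a cluster point.

   The stalk of the affine scheme at the ideal of x is the algebra of germs of C
   at x: by the bump functions, a in C is zero in the stalk iff a = 0 near x, and
   a fraction b / c with c(x) <> 0 equals b * h for any h in C inverse to c near
   x.  The comparison of sheaves evaluates a germ at the corresponding point.

   Local inverses and f are obtained by composing elements of C with smooth
   functions built from the flat function exp(-1/t). *)

From HB Require Import structures.
Require Import Defs.
From mathcomp Require Import all_boot all_order all_algebra.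
From mathcomp Require Import all_classical all_reals all_analysis.
From mathcomp Require Import ring lra.
Import Order.TTheory GRing.Theory Num.Theory.
Import numFieldNormedType.Exports.

Set Implicit Arguments.
Unset Strict Implicit.
Unset Printing Implicit Defensive.

Local Open Scope classical_set_scope.
Local Open Scope ring_scope.

(** * Smooth functions of one variable *)

Section SmoothOneVariable.
Variable R : realType.
Implicit Types f g : R -> R.

(** Derivatives are existential witnesses, so closure properties follow by induction on [n] with no
    formula for iterated derivatives. Smooth means [smooth_upto n] for every [n]. *)
Fixpoint smooth_upto (n : nat) (f : R -> R) : Prop :=
  if n is m.+1 then
    exists2 f' : R -> R, forall x : R, is_derive x 1 f (f' x) & smooth_upto m f'
  else True.

Lemma smooth_upto_pred n f : smooth_upto n.+1 f -> smooth_upto n f.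
Proof.
elim: n f => [//|n IH] f [f' df sf']; exists f' => //; exact: IH.
Qed.

Lemma smooth_upto_cst n (c : R) : smooth_upto n (cst c).
Proof.
elim: n c => [//|n IH] c; exists (cst 0) => // x; exact: is_derive_cst.
Qed.

Lemma smooth_upto_id n : smooth_upto n id.
Proof.
case: n => [//|n]; exists (cst 1) => [x|]; first exact: is_derive_id.
exact: smooth_upto_cst.
Qed.

Lemma smooth_uptoD n f g :
  smooth_upto n f -> smooth_upto n g -> smooth_upto n (fun x => f x + g x).
Proof.
elim: n f g => [//|n IH] f g [f' df sf'] [g' dg sg'].
exists (fun x => f' x + g' x) => [x|]; last exact: IH.
exact: is_deriveD.
Qed.

Lemma smooth_uptoM n f g :
  smooth_upto n f -> smooth_upto n g -> smooth_upto n (fun x => f x * g x).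
Proof.
elim: n f g => [//|n IH] f g sf sg.
have [f' df sf'] := sf; have [g' dg sg'] := sg.
exists (fun x => f x * g' x + g x * f' x) => [x|]; first exact: is_deriveM.
by apply: smooth_uptoD; apply: IH => //; exact: smooth_upto_pred.
Qed.

Lemma smooth_uptoV n f :
  (forall x, f x != 0) -> smooth_upto n f -> smooth_upto n (fun x => (f x)^-1).
Proof.
move=> f0; elim: n => [//|n IH] sf.
have sV := IH (smooth_upto_pred sf); have [f' df sf'] := sf.
exists (fun x => -1 * ((f x)^-1 * (f x)^-1) * f' x) => [x|]; last first.
  by do 2?apply: smooth_uptoM => //; [exact: smooth_upto_cst|exact: smooth_uptoM].
apply: (is_derive_eq (is_deriveV (f0 x) (df x))).
by rewrite -invfM mulN1r -expr2.
Qed.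

(** A row of length 1 has a single coordinate direction, so both difference quotients are the same
    function of [h]. *)
Let row_derive f (a : R) (v : 'rV[R]_1) (i : 'I_1) :
  is_derive (v 0 0) 1 f a ->
  is_derive v ('e_i : 'rV[R]_1) (fun w : 'rV[R]_1 => f (w 0 0)) a.
Proof.
move=> df.
have E : (fun h : R => h^-1 *: (((fun w : 'rV[R]_1 => f (w 0 0)) \o shift v)
      (h *: ('e_i : 'rV[R]_1)) - f (v 0 0))) =
    (fun h : R => h^-1 *: ((f \o shift (v 0 0)) (h *: (1 : R)) - f (v 0 0))).
  by apply/funext => h; rewrite /= !mxE !ord1 eqxx [_ *: _]/(_ * _).
have [d1 d2] := df.
by split; [rewrite /derivable E | rewrite -d2 /derive E].
Qed.

(** Each partial derivative costs one order of smoothness; the surplus [m] keeps the induction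
    going. *)
Let iter_partial_row (s : seq 'I_1) m f : smooth_upto (size s + m) f ->
  exists2 h, smooth_upto m h &
    iter_partial s (fun w : 'rV[R]_1 => f (w 0 0)) = fun w => h (w 0 0).
Proof.
elim: s m f => [|i s IH] m f sf; first by exists f.
have [|h [h' dh sh'] hE] := IH m.+1 f; first by rewrite addnS.
exists h' => //=; rewrite hE; apply/funext => v.
by have [] := row_derive i (dh (v 0 0)).
Qed.

Lemma smooth_on_row f : (forall n, smooth_upto n f) ->
  smooth_on setT (fun v : 'rV[R]_1 => f (v 0 0)).
Proof.
move=> sf s v _.
(* The one derivative kept in reserve by [m := 1] yields both continuity and derivability. *)
have [h [h' dh _] ->] := iter_partial_row (m := 1) (sf (size s + 1)%N).
split=> [|i]; last by have [] := row_derive i (dh (v 0 0)).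
apply: (@continuous_comp _ _ _ (fun w : 'rV[R]_1 => w 0 0) h).
  exact: coord_continuous.
apply: differentiable_continuous; apply/derivable1_diffP.
by have [] := dh (v 0 0).
Qed.

End SmoothOneVariable.

(** * The flat function exp(-1/t) and the smooth functions built from it *)

Section FlatFunction.
Variable R : realType.

(** The powers of 1/t are included because the span of the whole family, unlike that of exp(-1/t)
    alone, is stable under derivation. *)
Definition flat (k : nat) (t : R) : R :=
  if 0 < t then t^-1 ^+ k * expR (- t^-1) else 0.

Lemma flat_le0 k t : t <= 0 -> flat k t = 0.
Proof. by rewrite /flat leNgt => /negbTE ->. Qed.

Lemma flat_ge0 k t : 0 <= flat k t.
Proof.
rewrite /flat; case: ifPn => // t0.
by rewrite mulr_ge0 ?expR_ge0// exprn_ge0// invr_ge0 ltW.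
Qed.

(** With u = 1/t, raising u/(k+1) <= exp(u/(k+1)) to the power k+1 bounds u^(k+1) exp(-u); the spare
    factor u becomes |t|. *)
Lemma flat_bound k t : flat k t <= k.+1%:R ^+ k.+1 * `|t|.
Proof.
have [t0|t0] := leP t 0; first by rewrite flat_le0// mulr_ge0// exprn_ge0.
rewrite /flat t0 gtr0_norm//.
have u0 : 0 < t^-1 by rewrite invr_gt0.
have n0 : (0 : R) < k.+1%:R by rewrite ltr0n.
have : (t^-1 / k.+1%:R) ^+ k.+1 <= expR t^-1.
  have -> : expR t^-1 = expR (t^-1 / k.+1%:R) ^+ k.+1.
    by rewrite -expRM_natl mulrC divfK// lt0r_neq0.
  rewrite lerXn2r ?nnegrE ?expR_ge0 ?divr_ge0 ?ltW//.
  by rewrite (lt_le_trans _ (expR_ge1Dx _))// ltrDr.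
rewrite expRN ler_pdivrMr ?expR_gt0// => h.
have -> : t^-1 ^+ k = k.+1%:R ^+ k.+1 * t * (t^-1 / k.+1%:R) ^+ k.+1.
  rewrite exprMn (exprVn k.+1%:R) (exprS t^-1).
  have : k.+1%:R ^+ k.+1 != 0 :> R by rewrite expf_neq0// lt0r_neq0.
  move: (k.+1%:R ^+ k.+1) (t^-1 ^+ k) => a b a0.
  by field; rewrite a0 lt0r_neq0.
by rewrite ler_pM2l// mulr_gt0// exprn_gt0.
Qed.

(** Away from 0 this is calculus. At 0 the difference quotient of [flat k] is [flat k.+1], which
    tends to 0 by [flat_bound]. *)
Lemma is_derive_flat k (x : R) :
  is_derive x 1 (flat k) (flat k.+2 x - k%:R * flat k.+1 x).
Proof.
have [x0|x0|->{x}] := ltgtP x 0.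
- rewrite !flat_le0 ?(ltW x0)// mulr0 subr0.
  have c0 := @is_derive_cst _ R R 0 x 1.
  apply: near_eq_is_derive c0.
  by near=> y; rewrite flat_le0// ltW//; near: y; exact: lt_nbhsl.
- suff H : is_derive x 1 (fun t : R => t^-1 ^+ k * expR (- t^-1))
           (flat k.+2 x - k%:R * flat k.+1 x).
    apply: near_eq_is_derive H.
    by near=> y; rewrite /flat ifT//; near: y; exact: lt_nbhsr.
  have dV : is_derive x (1 : R) (fun t : R => t^-1) (- x ^- 2 *: 1).
    by apply: (@is_deriveV _ id); rewrite ?gt_eqF//.
  have dN : is_derive x (1 : R) (fun t : R => - t^-1) _ := is_deriveN dV.
  have dE := is_derive1_comp (g := fun t : R => - t^-1) (is_derive_expR _) dN.
  have := is_deriveM (is_deriveX k dV) dE; rewrite exprfctE => dM.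
  apply: (is_derive_eq dM) => {dM}.
  rewrite /flat x0 /GRing.scale /= mulr1.
  rewrite -exprVn; move: (expR _) => a.
  by case: k => [|k] /=; rewrite ?exprS ?expr0; ring.
- rewrite !flat_le0// mulr0 subr0.
  suff H : h^-1 *: ((flat k \o shift 0) (h *: (1 : R)) - flat k 0)
      @[h --> 0^'] --> (0 : R).
    by split; [apply/cvg_ex; exists 0 | exact/cvg_lim].
  have C0 : 0 < k.+2%:R ^+ k.+2 :> R by rewrite exprn_gt0.
  apply/cvgrPdist_lt => e e0; near=> h.
  have h0 : h != 0 by near: h; exact: nbhs_dnbhs_neq.
  have -> : h^-1 *: ((flat k \o shift 0) (h *: (1 : R)) - flat k 0) =
      flat k.+1 h.
    rewrite (flat_le0 k (lexx 0)) subr0 /= addr0 [h *: _]mulr1 /flat.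
    by case: ifPn; rewrite ?scaler0// exprS -mulrA.
  rewrite sub0r normrN ger0_norm ?flat_ge0// (le_lt_trans (flat_bound _ _))//.
  rewrite -ltr_pdivlMl//.
  near: h; apply: dnbhs0_lt.
  by rewrite mulr_gt0// invr_gt0.
Unshelve. all: by end_near. Qed.

Lemma smooth_upto_flat n k : smooth_upto n (flat k).
Proof.
elim: n k => [//|n IH] k.
exists (fun x => flat k.+2 x + (- k%:R) * flat k.+1 x) => [x|].
  by rewrite mulNr; exact: is_derive_flat.
by apply: smooth_uptoD => //; apply: smooth_uptoM => //; exact: smooth_upto_cst.
Qed.

(** The factor [expR 1] normalises the value at 0 to 1, so that products of cutoffs equal 1 where
    all arguments vanish. *)
Definition cutoff (t : R) : R := expR 1 * flat 0 (1 - t).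

Lemma cutoff_ge0 t : 0 <= cutoff t.
Proof. by rewrite mulr_ge0 ?expR_ge0 ?flat_ge0. Qed.

Lemma cutoff_ge1 t : 1 <= t -> cutoff t = 0.
Proof. by move=> t1; rewrite /cutoff flat_le0 ?mulr0// subr_le0. Qed.

Lemma cutoff0 : cutoff 0 = 1.
Proof.
by rewrite /cutoff /flat subr0 ltr01 expr0 mul1r invr1 expRN divff.
Qed.

(* A smooth positive function equal to 1 - u for u <= 0, so that its inverse is a
   smooth extension of 1 / (1 - u). *)
Definition pos_extension (u : R) : R := 1 - u + expR 1 * flat 0 u * (1 + u * u).

Lemma pos_extension_le0 u : u <= 0 -> pos_extension u = 1 - u.
Proof. by move=> u0; rewrite /pos_extension flat_le0// mulr0 mul0r addr0. Qed.

(** For u < 1 the term 1 - u is positive and the rest non-negative. For u >= 1 the coefficient of 1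
    + u^2 is at least 1, and 1 - u + 1 + u^2 > 0. *)
Lemma pos_extension_gt0 u : 0 < pos_extension u.
Proof.
have [u1|u1] := ltP u 1.
  rewrite /pos_extension ltr_wpDr ?subr_gt0// !mulr_ge0 ?expR_ge0 ?flat_ge0//.
  by rewrite addr_ge0// -expr2 sqr_ge0.
have e1 : 1 <= expR 1 * flat 0 u.
  rewrite /flat (lt_le_trans ltr01 u1) expr0 mul1r -expRD -[leLHS]expR0.
  by rewrite ler_expR subr_ge0 invf_le1// (lt_le_trans ltr01 u1).
rewrite /pos_extension; nra.
Qed.

Lemma smooth_upto_pos_extensionV n :
  smooth_upto n (fun u => (pos_extension u)^-1).
Proof.
apply: smooth_uptoV => [x|]; first by rewrite gt_eqF ?pos_extension_gt0.
have sc c := @smooth_upto_cst R n c; have si := @smooth_upto_id R n.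
have sf := smooth_upto_flat n 0.
have -> : pos_extension = fun u => 1 + -1 * u + expR 1 * flat 0 u * (1 + u * u).
  by apply/funext => u; rewrite mulN1r.
have s1 : smooth_upto n (fun u => 1 + -1 * u : R).
  by apply: smooth_uptoD; [exact: sc|exact: (smooth_uptoM (sc (-1)) si)].
have s2 : smooth_upto n (fun u => 1 + u * u : R).
  by apply: smooth_uptoD; [exact: sc|exact: (smooth_uptoM si si)].
exact: smooth_uptoD s1 (smooth_uptoM (smooth_uptoM (sc _) sf) s2).
Qed.

End FlatFunction.

(** * Differential spaces *)

Section DifferentialSpace.
Variables (R : realType) (S : differential_space R).
Implicit Types (f g h : S -> R) (x y : S).

Lemma dfun_near f :
  (forall x, exists2 g, dfun g & \forall y \near x, f y = g y) -> dfun f.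
Proof.
move=> fP; apply/dfun_local => x; have [g Cg fg] := fP x.
exists (interior [set y | f y = g y]), g.
split=> //; first exact: open_interior.
by move=> y /interior_subset.
Qed.

Lemma dfun_comp (s : R -> R) f :
  (forall n, smooth_upto n s) -> dfun f -> dfun (fun x => s (f x)).
Proof.
move=> ss Cf.
have := dfun_smooth (ltn0Sn 0) (fun _ => Cf) (smooth_on_row ss).
by congr dfun; apply/funext => x; rewrite mxE.
Qed.

Lemma dfun_near_neq0 f x : dfun f -> f x != 0 -> \forall y \near x, f y != 0.
Proof.
move=> Cf; exact: cvgr_neq0 (dfun_continuous Cf (x := x)).
Qed.

(** The rescaled function [u] takes the value 2 at [x], whatever the sign of [f x]. Where u > 1,
    [pos_extension (1 - u)] is u itself, while its inverse is smooth on the whole line and may be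
    composed with elements of C. *)
Lemma dfun_local_inverse f x : dfun f -> f x != 0 ->
  exists2 g, dfun g & \forall y \near x, f y * g y = 1.
Proof.
move=> Cf fx0; pose u y := 2 / f x * f y.
have Cu : dfun u := dfunZ (2 / f x) Cf.
have C1u : dfun (fun y => 1 - u y) := dfunB (dfun1 S) Cu.
exists (fun y => 2 / f x * (pos_extension (1 - u y))^-1).
  exact: (dfunZ (2 / f x) (dfun_comp (@smooth_upto_pos_extensionV R) C1u)).
have u1 : \forall y \near x, 1 < u y.
  have : 1 < u x by rewrite /u divfK// ltr1n.
  by move=> /lt_nbhsr; exact: (dfun_continuous Cu).
near=> y; have uy : 1 < u y by near: y.
rewrite pos_extension_le0 ?subr_le0 ?ltW// opprB addrC subrK mulrA mulrC mulrA.
by rewrite -mulrA (mulrC (f y)) -/(u y) mulVf// gt_eqF// (lt_trans _ uy).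
Unshelve. all: by end_near. Qed.

Lemma dfunV f : dfun f -> (forall x, f x != 0) -> dfun (fun x => (f x)^-1).
Proof.
move=> Cf f0; apply: dfun_near => x.
have [g Cg fg] := dfun_local_inverse Cf (f0 x); exists g => //.
near=> y; apply: (mulfI (f0 y)); rewrite divff//.
by apply/esym; near: y.
Unshelve. all: by end_near. Qed.

Lemma dfun_sum (I : Type) (r : seq I) (u : I -> S -> R) :
  (forall i, dfun (u i)) -> dfun (fun x => \sum_(i <- r) u i x).
Proof.
move=> Cu; elim: r => [|i r IH].
  by under eq_fun do rewrite big_nil; exact: dfun_cst.
by under eq_fun do rewrite big_cons; exact: (dfunD (Cu i) IH).
Qed.

Lemma dfun_prod (I : Type) (r : seq I) (u : I -> S -> R) :
  (forall i, dfun (u i)) -> dfun (fun x => \prod_(i <- r) u i x).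
Proof.
move=> Cu; elim: r => [|i r IH].
  by under eq_fun do rewrite big_nil; exact: dfun_cst.
by under eq_fun do rewrite big_cons; exact: (dfunM (Cu i) IH).
Qed.

(** Each value is a finite sum cut at a chosen bound, and extra zero terms do not change it. Near a
    point one bound serves all points, so local detectability applies. *)
Lemma dfun_locally_finite_sum (u : nat -> S -> R) :
  (forall i, dfun (u i)) ->
  (forall x, exists N, \forall y \near x, forall i, (N <= i)%N -> u i y = 0) ->
  exists2 f, dfun f & forall x N, (forall i, (N <= i)%N -> u i x = 0) ->
    f x = \sum_(0 <= i < N) u i x.
Proof.
move=> Cu lf.
have ex x : exists N, forall i, (N <= i)%N -> u i x = 0.
  by have [N /nbhs_singleton] := lf x; exists N.
pose f x := \sum_(0 <= i < projT1 (cid (ex x))) u i x.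
have sum_tail x M N : (M <= N)%N -> (forall i, (M <= i)%N -> u i x = 0) ->
    \sum_(0 <= i < M) u i x = \sum_(0 <= i < N) u i x.
  move=> MN uM; rewrite [RHS](big_cat_nat (n := M))//= [X in _ + X]big_nat.
  by rewrite [X in _ + X]big1 ?addr0// => i /andP[/uM ->].
have fE x N : (forall i, (N <= i)%N -> u i x = 0) ->
    f x = \sum_(0 <= i < N) u i x.
  rewrite /f; case: (cid (ex x)) => /= M uM uN.
  by have [/sum_tail|/ltnW/sum_tail] := leqP M N; [apply|move=> E; rewrite -E].
exists f => //; apply: dfun_near => x; have [N uN] := lf x.
exists (fun y => \sum_(0 <= i < N) u i y); first exact: dfun_sum.
by apply: filterS uN => y /fE.
Qed.

End DifferentialSpace.

(** * An exhaustion function *)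

Section ExhaustionFunction.
Variables (R : realType) (S : differential_space R).
Hypothesis S_loc_compact : locally_compact [set: S].
Hypothesis S_second_countable : @second_countable S.
Hypothesis S_bump : forall (x : S) (U : set S), open U -> U x ->
  exists rho : S -> R, [/\ dfun rho, forall y, 0 <= rho y,
    rho x != 0 & closure [set y | rho y != 0] `<=` U].

Let bump (rho : S -> R) := [/\ dfun rho, forall y, 0 <= rho y &
  compact (closure [set y | rho y != 0])].

Let bump_at (x : S) : exists2 rho, bump rho & rho x != 0.
Proof.
have [U wU [cptU clU]] := S_loc_compact (x := x) I.
have Ux : nbhs x U.
  by apply: filterS (wU : nbhs x (fun y => setT y -> U y)) => y; exact.
have [rho [Crho rho0 rhox rhoU]] := S_bump (open_interior U) Ux.
exists rho => //; split=> //.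
apply: (subclosed_compact _ cptU); first exact: closed_closure.
exact: subset_trans rhoU (@interior_subset _ _).
Qed.

(** For each basic open set on which some bump function has no zero, one such function is chosen; it
    is indexed by the code of the set in the countable base. *)
Let bump_cover : exists2 rho : nat -> S -> R,
  forall i, bump (rho i) & forall x, exists i, rho i x != 0.
Proof.
have [B /countable_injP[code codeI] [Bopen Bbase]] := S_second_countable.
pose good b rho := bump rho /\ b `<=` [set y | rho y != 0].
have ex i : exists rho, bump rho /\
    forall b, B b -> code b = i -> (exists rho', good b rho') -> good b rho.
  have [[b [Bb bi [rho rhob]]]|nex] :=
      pselect (exists b, [/\ B b, code b = i & exists rho, good b rho]).
    exists rho; split=> [|c Bc ci _]; first by case: rhob.
    suff -> : c = b by [].
    by apply: codeI; rewrite ?inE// bi.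
  (* Indices that code no such basic set receive the zero function. *)
  exists (cst 0); split=> [|b Bb bi bex]; last by exfalso; apply: nex; exists b.
  split=> //; first exact: dfun_cst.
  rewrite (_ : [set y | _] = set0) ?closure0; first exact: compact0.
  by rewrite -subset0 => y /=; rewrite eqxx.
have [rho rhoP] := choice ex; exists rho => [i|x]; first by case: (rhoP i).
have [rho' bump' rho'x] := bump_at x.
have [Crho' _ _] := bump'.
have [b [Bb bx] brho'] := Bbase x _ (dfun_near_neq0 Crho' rho'x).
exists (code b); have [_ /(_ b Bb erefl)[|_]] := rhoP (code b).
  by exists rho'.
exact.
Qed.

(** The function is the sum of the [u i] below. Outside the supports of the first n bump functions
    its first n terms are 1, so it is at least n there; a fibre over r < n therefore lies in the
    union of these supports. *)
Lemma exhaustion_function : exists2 f : S -> R, dfun f &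
  forall r, exists2 K, compact K & f @^-1` [set r] `<=` K.
Proof.
have [rho rhoP rho_cover] := bump_cover.
(* If rho j x > 0, the j-th factor of [u i] vanishes near x as soon as
   i >= 2 / rho j x; if rho j x = 0 for all j < n, the first n terms are 1. *)
pose u i x := \prod_(0 <= j < i) cutoff (i%:R * rho j x).
have Cu i : dfun (u i).
  apply: dfun_prod => j; have [Crho _ _] := rhoP j.
  have C1 : dfun (fun x => 1 - i%:R * rho j x).
    exact: (dfunB (dfun1 S) (dfunZ i%:R Crho)).
  exact: (dfunZ (expR 1) (dfun_comp (fun n => smooth_upto_flat R n 0) C1)).
have lf (x : S) :
    exists N, \forall y \near x, forall i, (N <= i)%N -> u i y = 0.
  have [j rhojx] := rho_cover x; have [Crho rho0 _] := rhoP j.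
  have rhox : 0 < rho j x by rewrite lt_neqAle eq_sym rhojx rho0.
  (* The bound [j.+1] ensures that the factor of index [j] occurs in the product. *)
  pose N := (maxn j.+1 (Num.bound (2 / rho j x))); exists N.
  have : \forall y \near x, rho j x / 2 < rho j y.
    have /lt_nbhsr : rho j x / 2 < rho j x.
      by rewrite ltr_pdivrMr// ltr_pMr// ltr1n.
    exact: (dfun_continuous Crho).
  apply: filterS => y rhoy i; rewrite geq_max => /andP[ji Ni].
  rewrite /u big_mkord (bigD1 (Ordinal ji))//= cutoff_ge1 ?mul0r//.
  have /ltW h : 2 / rho j x < i%:R.
    rewrite (@lt_le_trans _ _ (Num.bound (2 / rho j x))%:R) ?ler_nat//.
    by rewrite archi_boundP// divr_ge0 ?ltW.
  rewrite (@le_trans _ _ (2 / rho j x * (rho j x / 2)))//.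
    by rewrite mulrA divfK ?divff// gt_eqF.
  by rewrite ler_pM// ?divr_ge0// ltW.
have [f Cf fE] := dfun_locally_finite_sum Cu lf.
exists f => // r.
pose n := Num.bound `|r|.
exists (\bigcup_(j < n) closure [set y | rho j y != 0]).
  by rewrite bigcup_mkord; apply: bigsetU_compact => j _; have [_ _] := rhoP j.
move=> x /= fxr; apply: contrapT => Kx.
have [N /nbhs_singleton uN] := lf x.
have rhox j : (j < n)%N -> rho j x = 0.
  move=> jn; apply/eqP/negP => /negP rhojx; apply: Kx.
  by exists j => //; exact: subset_closure.
have ux i : (i < n)%N -> u i x = 1.
  move=> ilt; rewrite /u big_nat big1// => j /andP[_ ji].
  by rewrite rhox ?mulr0 ?cutoff0// (ltn_trans ji).
have : r < n%:R by apply: le_lt_trans (archi_boundP _); rewrite ?ler_norm.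
suff : n%:R <= f x by rewrite fxr leNgt => /negP.
rewrite (fE x (maxn n N)) => [|i]; last by rewrite geq_max => /andP[_ /uN].
rewrite (big_cat_nat (n := n)) ?leq_maxl//= ler_wpDr//.
  by apply: sumr_ge0 => i _; apply: prodr_ge0 => j _; exact: cutoff_ge0.
rewrite big_nat (eq_bigr (fun=> 1)) => [|i /andP[_ /ux]//].
by rewrite -big_nat sumr_const_nat subn0.
Qed.

End ExhaustionFunction.

(** * The real spectrum of the algebra of global sections *)

Section GlobalSections.
Variables (R : realType) (S : differential_space R).
Local Notation A := (global_sections S).
Implicit Types (a b : A) (x : S).

Definition gval a : S -> R := fun x => sval a x I.

(** Local detectability turns a globally defined, locally extendable function into an element of C;
    with [gsect] this identifies [A] with C. *)
Lemma gval_dfun a : dfun (gval a).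
Proof.
apply: dfun_near => x.
have /asboolP /(_ x I) [V [VT [Vx [h Ch hE]]]] := svalP a.
exists h => //; apply: filterS (open_nbhs_nbhs (conj (osetP V) Vx)) => y Vy.
by rewrite -(hE y Vy); exact: (dsect_irr (sval a)).
Qed.

Lemma gval_inj a b : gval a = gval b -> a = b.
Proof.
move=> ab; apply: val_inj; apply: dsectP => x [].
exact: (congr1 (fun f => f x) ab).
Qed.

Lemma gsect_subproof (f : S -> R) : dfun f ->
  locally_lcb (extendable_lc S) ((fun x _ => f x) : dsect _ (opensT S)).
Proof.
move=> Cf; apply/asboolP => x _; exists (opensT S), (@subset_refl _ _).
by split=> //; exists f.
Qed.

Definition gsect (f : S -> R) (Cf : dfun f) : A :=
  exist (fun s => locally_lcb (extendable_lc S) s) _ (gsect_subproof Cf).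

Lemma gsectK (f : S -> R) (Cf : dfun f) : gval (gsect Cf) = f.
Proof. by []. Qed.

Lemma gvalB a b x : gval (a - b) x = gval a x - gval b x.
Proof. by []. Qed.

Lemma gvalD a b x : gval (a + b) x = gval a x + gval b x.
Proof. by []. Qed.

Lemma gvalM a b x : gval (a * b) x = gval a x * gval b x.
Proof. by []. Qed.

Lemma gval1 x : gval 1 x = 1.
Proof. by []. Qed.

Lemma gval0 x : gval 0 x = 0.
Proof. by []. Qed.

Lemma gval_alg r x : gval (global_alg S r) x = r.
Proof. by []. Qed.

Definition eval_ideal x : ideal A.
Proof.
refine (@Ideal A [set a | gval a x = 0] _ _ _).
- exact: gval0.
- by move=> a b a0 b0; apply: etrans (gvalD a b x) _; rewrite a0 b0 addr0.
- by move=> a b b0; apply: etrans (gvalM a b x) _; rewrite b0 mulr0.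
Defined.

Lemma eval_idealP x a : iset (eval_ideal x) a = (gval a x = 0).
Proof. by []. Qed.

Lemma eval_ideal_prime x : prime_ideal (eval_ideal x).
Proof.
split=> [/eqP|a b /eqP]; first by rewrite gval1 oner_eq0.
by rewrite gvalM mulf_eq0 => /orP[]/eqP; [left|right].
Qed.

Definition eval_spec x : spec A := Spec (eval_ideal_prime x).

(** An ideal containing the functions that vanish at [x] and also some [a] with a(x) <> 0 contains
    the constant a(x), which is a unit. *)
Lemma eval_ideal_maximal x : maximal_ideal (eval_ideal x).
Proof.
split=> [/eqP|J IJ J1 a Ja]; first by rewrite gval1 oner_eq0.
apply: contrapT => /eqP ax0; apply: J1.
have Jr : iset J (global_alg S (gval a x)).
  rewrite -(subKr a (global_alg S _)); apply: idealB => //.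
  by apply: IJ; rewrite eval_idealP gvalB gval_alg subrr.
rewrite -(rmorph1 (global_alg S)) -(mulVf ax0) rmorphM.
exact: idealMl.
Qed.

Definition eval_quot x (q : quot_ring (eval_ideal x)) : R := gval (rs_repr q) x.

Lemma eval_quotE x a : eval_quot (quot_class (eval_ideal x) a) = gval a x.
Proof.
have : iset (eval_ideal x) (rs_repr (quot_class (eval_ideal x) a) - a).
  exact: (rs_class_repr (a : quot_setoid (eval_ideal x))).
by rewrite eval_idealP gvalB => /eqP; rewrite subr_eq0 => /eqP.
Qed.

Let eval_quot_class x (a : quot_setoid (eval_ideal x)) :
  eval_quot (rs_class a) = gval a x.
Proof. exact: eval_quotE. Qed.

Lemma eval_quot_zmod x : zmod_morphism (@eval_quot x).
Proof.
move=> p q; rewrite -(rs_reprK p) -(rs_reprK q) -rs_classN -rs_classD.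
by rewrite !eval_quot_class.
Qed.

Lemma eval_quot_monoid x : monoid_morphism (@eval_quot x).
Proof.
split=> [|p q]; first by rewrite -rs_class1 eval_quot_class.
by rewrite -(rs_reprK p) -(rs_reprK q) -rs_classM !eval_quot_class.
Qed.

HB.instance Definition _ x := GRing.isZmodMorphism.Build
  (quot_ring (eval_ideal x)) R (@eval_quot x) (@eval_quot_zmod x).
HB.instance Definition _ x := GRing.isMonoidMorphism.Build
  (quot_ring (eval_ideal x)) R (@eval_quot x) (@eval_quot_monoid x).

Lemma eval_spec_real x : real_spec (global_alg S) (eval_spec x).
Proof.
split; first exact: eval_ideal_maximal.
exists (@eval_quot x); split=> [|r]; last exact: eval_quotE.
exists (fun r => quot_class (eval_ideal x) (global_alg S r)) => [q|r].
  rewrite -[RHS]rs_reprK; apply/rs_classP.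
  rewrite -[rs_eq _ _]/(iset (eval_ideal x) (_ - _)) eval_idealP.
  by rewrite gvalB gval_alg subrr.
exact: eval_quotE.
Qed.

Hypothesis S_loc_compact : locally_compact [set: S].
Hypothesis S_second_countable : @second_countable S.
Hypothesis S_bump : forall (x : S) (U : set S), open U -> U x ->
  exists rho : S -> R, [/\ dfun rho, forall y, 0 <= rho y,
    rho x != 0 & closure [set y | rho y != 0] `<=` U].

Lemma real_spec_eval (m : spec A) : real_spec (global_alg S) m ->
  exists x, iset m = iset (eval_ideal x).
Proof.
move=> [[m1 mmax] [phi [/bij_inj phiI phiE]]].
(* Maximality of [m] turns this inclusion into an equality. *)
suff [x mx] : exists x, m `<=` eval_ideal x.
  exists x; apply/seteqP; split=> //; apply: mmax => //.
  by have [] := eval_ideal_maximal x.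
have m_nonunit a : iset m a -> exists x, gval a x = 0.
  move=> ma; apply: contrapT => /forallNP a0; apply: m1.
  have a0' x : gval a x != 0 by apply/eqP.
  rewrite (_ : 1 = gsect (dfunV (gval_dfun a) a0') * a); first exact: idealMl.
  apply: gval_inj; apply/funext => x.
  by rewrite gvalM gsectK mulVf.
pose F : set_system S := [set X | exists2 a, iset m a &
  [set x | gval a x = 0] `<=` X].
have FF : ProperFilter F.
  apply: Build_ProperFilter_ex.
    by move=> X [a /m_nonunit[x ax] aX]; exists x; exact: aX.
  split.
  - by exists 0 => //; exact: ideal0.
  (* A sum of two real squares vanishes exactly where both terms do. *)
  - move=> X Y [a ma aX] [b mb bY]; exists (a * a + b * b).
      by apply: idealD; exact: idealMl.
    move=> x abx; move/eqP: (abx : gval (a * a + b * b) x = 0).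
    rewrite gvalD !gvalM -!expr2 paddr_eq0 ?sqr_ge0//.
    by rewrite !sqrf_eq0 => /andP[/eqP ax /eqP bx]; split; [exact: aX|exact: bY].
  - move=> X Y XY [a ma aX]; exists a => //; exact: subset_trans XY.
have [f Cf fK] := exhaustion_function S_loc_compact S_second_countable S_bump.
pose r := phi (quot_class m (gsect Cf)).
have mf : iset m (gsect Cf - global_alg S r).
  suff /rs_classP : quot_class m (gsect Cf) = quot_class m (global_alg S r).
    exact.
  by apply: phiI; rewrite phiE.
have [K cptK rK] := fK r.
have [|x [Kx Fx]] := cptK F FF.
  exists (gsect Cf - global_alg S r) => // x fx.
  move/eqP: (fx : gval (gsect Cf - global_alg S r) x = 0).
  by rewrite gvalB gsectK gval_alg subr_eq0 => /eqP; exact: rK.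
(* Otherwise the zero set of [a], a member of [F], would miss a neighbourhood of the cluster
   point. *)
exists x => a ma; apply: contrapT => /eqP ax0.
have Fa : F [set y | gval a y = 0] by exists a.
have [y [ay /negP]] := Fx _ _ Fa (dfun_near_neq0 (gval_dfun a) ax0).
by apply; exact/eqP.
Qed.

End GlobalSections.

(** * The structure sheaf on the real spectrum *)

Lemma spec_eq (A : comPzRingType) (p q : spec A) : iset p = iset q -> p = q.
Proof.
case: p q => [[I I0 ID IM] Ip] [[J J0 JD JM] Jp] /= IJ; subst J.
have E : Ideal I0 ID IM = Ideal J0 JD JM by congr Ideal; exact: Prop_irrelevance.
by move: Jp; rewrite -E => Jp; congr Spec; exact: Prop_irrelevance.
Qed.

Section SpecGerms.
Variable A : comPzRingType.
Implicit Types (a b : A) (p : spec A).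
Local Notation O := (rsheaf (affine_scheme A)).

Lemma basic_open_subproof a : open [set p : spec A | ~ iset p a].
Proof.
exists [set a] => //; apply/seteqP; split=> p /= pa.
  by move=> pa'; apply: pa => _ ->.
by move=> /(_ a erefl).
Qed.

Definition basic_open a : opens (spec A) := Opens (basic_open_subproof a).

Lemma elem_sect_subproof a : locally_lcb (spec_lc A)
  ((fun p _ => Defs.frac a (@spec1 A p)) :
    dsect (fun p => localization p) (opensT _)).
Proof.
apply/asboolP => p _; exists (opensT _), (@subset_refl _ _); split=> //.
by exists a, 1 => q Vq; exists (@spec1 A q).
Qed.

Definition elem_sect a : O (opensT (spec A)) :=
  exist (fun s => locally_lcb (spec_lc A) s) _ (elem_sect_subproof a).

(** The canonical map from [A] to the stalk, sending a to the germ of a/1. At real points it is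
    onto, which reduces computations in stalks to [A]. *)
Definition elem_germ p a : stalk O p :=
  germ (I : oset (opensT (spec A)) p) (elem_sect a).

Lemma elem_germ1 p : elem_germ p 1 = 1.
Proof.
rewrite /elem_germ -(germ1 O (I : oset (opensT (spec A)) p)); congr germ.
exact: val_inj.
Qed.

Lemma elem_germB p a b : elem_germ p (a - b) = elem_germ p a - elem_germ p b.
Proof.
rewrite /elem_germ -germB; congr germ; apply: val_inj; apply: dsectP => q Uq.
apply: etrans (esym (Defs.fracB _ _ _ _)); apply/Defs.fracP.
by exists 1; [exact: spec1 | ring].
Qed.

Lemma elem_germM p a b : elem_germ p (a * b) = elem_germ p a * elem_germ p b.
Proof.
rewrite /elem_germ -germM; congr germ; apply: val_inj; apply: dsectP => q Uq.
apply: etrans (esym (Defs.fracM _ _ _ _)); apply/Defs.fracP.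
by exists 1; [exact: spec1 | ring].
Qed.

(** The relation gives a/1 = b/1 at every prime not containing [c], and these form an open
    neighbourhood of [p]. *)
Lemma elem_germ_eq p a b c : ~ iset p c -> c * a = c * b ->
  elem_germ p a = elem_germ p b.
Proof.
move=> pc cab; apply/germP.
exists (basic_open c), (@subsetT _ _), (@subsetT _ _); split=> //.
apply: val_inj; apply: dsectP => q qc; apply/Defs.fracP.
by exists c => //; rewrite !mulr1.
Qed.

End SpecGerms.

(** * Points, stalks and sections compared between S and the real spectrum *)

Section StratifoldSpectrum.
Variables (R : realType) (S : differential_space R).
Local Notation A := (global_sections S).
Local Notation O := (rsheaf (affine_scheme A)).
Local Notation Y := (real_affine_space (global_alg S)).
Implicit Types (a b : A) (x : S) (p : spec A).

Hypothesis S_hausdorff : hausdorff_space S.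
Hypothesis S_loc_compact : locally_compact [set: S].
Hypothesis S_second_countable : @second_countable S.
Hypothesis S_bump : forall (x : S) (U : set S), open U -> U x ->
  exists rho : S -> R, [/\ dfun rho, forall y, 0 <= rho y,
    rho x != 0 & closure [set y | rho y != 0] `<=` U].

Let bump_near x (U : set S) : nbhs x U ->
  exists2 c : A, gval c x != 0 & forall y, gval c y != 0 -> U y.
Proof.
move=> xU; have [rho [Crho _ rhox rhoU]] := S_bump (open_interior U) xU.
exists (gsect Crho) => // y rhoy; apply: interior_subset; apply: rhoU.
exact: subset_closure.
Qed.

Let bump_germ x a b : (\forall y \near x, gval a y = gval b y) ->
  exists2 c : A, gval c x != 0 & c * a = c * b.
Proof.
move=> /bump_near[c cx cab]; exists c => //; apply: gval_inj; apply/funext => y.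
rewrite !gvalM; have [->|/cab ->//] := eqVneq (gval c y) 0.
by rewrite !mul0r.
Qed.

(** Stated up to equality of ideals because the points of [Y] are tied to points of S only through
    such an equality. *)
Let not_mem p x a : iset p = iset (eval_ideal x) ->
  (~ iset p a) = (gval a x != 0).
Proof.
by move=> ->; apply/propext; split=> [/eqP|/eqP].
Qed.

Lemma eval_spec_continuous : continuous (@eval_spec R S).
Proof.
apply/continuousP => _ [E _ <-].
rewrite (_ : _ @^-1` _ = \bigcup_(a in E) [set x | gval a x != 0]).
  apply: bigcup_open => a _; rewrite openE => x /= ax.
  exact: dfun_near_neq0 (gval_dfun a) ax.
apply/seteqP; split=> x /=.
  move=> /existsNP[a /not_implyP[Ea ax]]; exists a => //=.
  by rewrite -(@not_mem (eval_spec x) x a erefl).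
move=> [a Ea /eqP ax] Ex; apply: ax; exact: Ex.
Qed.

(** From right to left, multiply by a bump function supported where [a] and [b] agree. Conversely,
    by continuity equality of germs passes to [eval_spec y] for [y] near [x]; there it yields
    [u * a = u * b] with [u] non-zero at [y]. *)
Lemma elem_germP p x a b : iset p = iset (eval_ideal x) ->
  elem_germ p a = elem_germ p b <-> \forall y \near x, gval a y = gval b y.
Proof.
move=> px; split; last first.
  move=> /bump_germ[c cx]; apply: elem_germ_eq; by rewrite (not_mem _ px).
have -> : p = eval_spec x by exact: spec_eq.
move=> /germP[W [WT [WT' [Wx E]]]].
have Wx' : nbhs x (@eval_spec R S @^-1` W).
  by apply: eval_spec_continuous; exact: (open_nbhs_nbhs (conj (osetP W) Wx)).
apply: filterS Wx' => y Wy.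
have := congr1 (fun t : local_sect (spec_lc A) W => sval t (eval_spec y) Wy) E.
move=> /Defs.fracP[u uy]; rewrite !mulr1 => /(congr1 (fun e : A => gval e y)).
rewrite !gvalM; apply: mulfI.
by rewrite -(@not_mem (eval_spec y) y u erefl).
Qed.

(** Near [p] the section is a fraction b/c. With [h] inverse to [c] near [x], a bump function [d]
    turns this into the identity [d * (c * h) = d] in [A], so b/c = bh/1 at every prime of the
    smaller open set that avoids [d], real or not. *)
Lemma section_near p x (W : opens (spec A)) (Wp : oset W p) (t : O W) :
  iset p = iset (eval_ideal x) ->
  exists a (V : opens (spec A)) (VW : V `<=` W), oset V p /\
    forall q (Vq : oset V q), germ (VW q Vq : oset W q) t = elem_germ q a.
Proof.
move=> px; have /asboolP /(_ p Wp) [V [VW [Vp [b [c tE]]]]] := svalP t.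
have [pc _] := tE p Vp; have cx : gval c x != 0 by rewrite -(not_mem _ px).
have [h Ch ch] := dfun_local_inverse (gval_dfun c) cx.
have [d dx dE] : exists2 d : A, gval d x != 0 & d * (c * gsect Ch) = d * 1.
  exact: bump_germ.
pose V' := opensI V (basic_open d).
have V'W : V' `<=` W by move=> q [/VW].
exists (b * gsect Ch), V', V'W; split=> [|q V'q].
  by split=> //; rewrite /= (not_mem _ px).
apply/germP; exists V', V'W, (@subsetT _ _); split=> //.
apply: val_inj; apply: dsectP => r V'r; have [Vr dr] := V'r.
have [rc tr] := tE r Vr.
apply: etrans (etrans (dsect_irr (sval t) _ _) tr) _.
apply/Defs.fracP; exists d => //.
rewrite (_ : d * (b * _ * c) = b * (d * (c * gsect Ch))); last by ring.
by rewrite dE; ring.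
Qed.

(** Distinct points are separated by a bump function at [x] that vanishes at [y]. *)
Lemma eval_ideal_inj x y : iset (eval_ideal x) = iset (eval_ideal y) -> x = y.
Proof.
move=> xy; apply/eqP/negP => /negP /(hausdorff_accessible S_hausdorff).
move=> [U [oU /set_mem Ux /set_mem Uy]].
have [c cx cU] := bump_near (open_nbhs_nbhs (conj oU Ux)).
have : ~ iset (eval_ideal x) c by apply/eqP.
by rewrite xy eval_idealP => /eqP /cU.
Qed.

Definition real_point x : Y :=
  exist _ (eval_spec x) (mem_set (eval_spec_real x)).

Let real_pointP (y : Y) :=
  real_spec_eval S_loc_compact S_second_countable S_bump (set_valP y).

Definition point_of (y : Y) : S := sval (cid (real_pointP y)).

Lemma point_ofP (y : Y) :
  iset (set_val y : spec A) = iset (eval_ideal (point_of y)).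
Proof. exact: svalP (cid (real_pointP y)). Qed.

Lemma real_pointK : cancel real_point point_of.
Proof. by move=> x; apply/esym/eval_ideal_inj; rewrite -point_ofP. Qed.

Lemma point_ofK : cancel point_of real_point.
Proof. by move=> y; apply/val_inj/spec_eq; rewrite /= point_ofP. Qed.

Lemma real_point_continuous : continuous real_point.
Proof. by apply: continuous_comp_initial; exact: eval_spec_continuous. Qed.

(** A bump function [c] supported in the given neighbourhood defines a basic open set of the
    spectrum whose real points all map into it. *)
Lemma point_of_continuous : continuous point_of.
Proof.
move=> y U /bump_near[c cy cU].
have set_val_cont : continuous (set_val : Y -> spec A).
  exact: initial_continuous.
have yc : oset (basic_open c) (set_val y).
  by rewrite /= (not_mem _ (point_ofP y)).
have : nbhs y ((set_val : Y -> spec A) @^-1` basic_open c).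
  apply: set_val_cont.
  exact: (open_nbhs_nbhs (conj (osetP (basic_open c)) yc)).
apply: filterS => z /=; rewrite (not_mem _ (point_ofP z)); exact: cU.
Qed.

(** A global element with germ [z] always exists by [elem_germ_surj], so the default 0 is never
    taken; [stalk_valueE] shows that the choice does not matter. *)
Definition stalk_value (y : Y) (z : stalk O (set_val y)) : R :=
  gval (xget 0 [set a | elem_germ (set_val y) a = z]) (point_of y).

Lemma stalk_valueE (y : Y) a :
  stalk_value (elem_germ (set_val y) a) = gval a (point_of y).
Proof.
rewrite /stalk_value; case: xgetP => [b _ ba|/(_ a) nex]; last first.
  by exfalso; exact: nex.
by have /(elem_germP _ _ (point_ofP y)) /nbhs_singleton := ba.
Qed.

Lemma elem_germ_surj (y : Y) (z : stalk O (set_val y)) :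
  exists a, elem_germ (set_val y) a = z.
Proof.
rewrite -(rs_reprK z); case: (rs_repr z) => W Wy t.
have [a [V [VW [Vy tE]]]] := section_near Wy t (point_ofP y).
exists a; rewrite -(tE _ Vy); congr germ; exact: Prop_irrelevance.
Qed.

Lemma stalk_value_zmod (y : Y) : zmod_morphism (@stalk_value y).
Proof.
move=> z z'; have [a <-] := elem_germ_surj z; have [b <-] := elem_germ_surj z'.
by rewrite -elem_germB !stalk_valueE.
Qed.

Lemma stalk_value_monoid (y : Y) : monoid_morphism (@stalk_value y).
Proof.
split=> [|z z']; first by rewrite -elem_germ1 stalk_valueE.
have [a <-] := elem_germ_surj z; have [b <-] := elem_germ_surj z'.
by rewrite -elem_germM !stalk_valueE.
Qed.

Definition Ylc := inverse_image_lc (set_val : Y -> spec A) O.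

(** Two localisations combine: the section is locally given by one section of the affine scheme,
    which in turn is locally given by one element of [A]. *)
Lemma inverse_image_near (V : opens Y) (s : local_sect Ylc V)
    (y : Y) (Vy : oset V y) :
  exists a, \forall z \near y, forall Vz : oset V z,
    sval s z Vz = elem_germ (set_val z) a.
Proof.
have /asboolP /(_ y Vy) [V1 [V1V [V1y [W [t [V1W sE]]]]]] := svalP s.
have [a [V2 [V2W [V2y tE]]]] := section_near (V1W y V1y) t (point_ofP y).
exists a.
have V1n : nbhs y V1 := open_nbhs_nbhs (conj (osetP V1) V1y).
have V2n : nbhs y ((set_val : Y -> spec A) @^-1` V2).
  have set_val_cont : continuous (set_val : Y -> spec A).
    exact: initial_continuous.
  apply: set_val_cont; exact: (open_nbhs_nbhs (conj (osetP V2) V2y)).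
near=> z => Vz; have V1z : oset V1 z by near: z.
have V2z : oset V2 (set_val z) by near: z.
rewrite -(tE _ V2z).
apply: etrans (etrans (dsect_irr (sval s) _ _) (sE z V1z)) _.
congr germ; exact: Prop_irrelevance.
Unshelve. all: by end_near. Qed.

Local Notation preim := (preim_opens real_point_continuous).

Lemma comparison_subproof (V : opens Y) (s : local_sect Ylc V) :
  locally_lcb (extendable_lc S)
    ((fun x Vx => stalk_value (sval s (real_point x) Vx)) : dsect _ (preim V)).
Proof.
apply/asboolP => x Vx; have [a sa] := inverse_image_near s Vx.
pose N : set S := [set x' | forall Vz : oset V (real_point x'),
  sval s _ Vz = elem_germ (set_val (real_point x')) a].
have xN : nbhs x N by exact: real_point_continuous sa.
exists (opensI (Opens (open_interior N)) (preim V)), (@subIsetr _ _ _).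
split=> //; exists (gval a); first exact: gval_dfun.
move=> x' Vx'; have [/interior_subset Nx' _] := Vx'.
by rewrite /dres Nx' stalk_valueE real_pointK.
Qed.

Definition comparison (V : opens Y) (s : local_sect Ylc V) :
  local_sect (extendable_lc S) (preim V) :=
  exist (fun h => locally_lcb (extendable_lc S) h) _ (comparison_subproof s).

Lemma comparison_zmod V : zmod_morphism (@comparison V).
Proof.
move=> s t; apply: val_inj; apply: dsectP => x Vx; exact: stalk_value_zmod.
Qed.

Lemma comparison_monoid V : monoid_morphism (@comparison V).
Proof.
split=> [|s t]; apply: val_inj; apply: dsectP => x Vx.
  exact: (stalk_value_monoid _).1.
exact: (stalk_value_monoid _).2.
Qed.

HB.instance Definition _ V := GRing.isZmodMorphism.Build
  (local_sect Ylc V) (local_sect (extendable_lc S) (preim V))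
  (@comparison V) (@comparison_zmod V).
HB.instance Definition _ V := GRing.isMonoidMorphism.Build
  (local_sect Ylc V) (local_sect (extendable_lc S) (preim V))
  (@comparison V) (@comparison_monoid V).

Section Inverse.
Variables (V : opens Y) (h : local_sect (extendable_lc S) (preim V)).

Let agrees x a := \forall z \near x, forall Vz : oset (preim V) z,
  sval h z Vz = gval a z.

Let agrees_ex x : oset (preim V) x -> exists a, agrees x a.
Proof.
move=> Vx; have /asboolP /(_ x Vx) [U [UV [Ux [f Cf fE]]]] := svalP h.
exists (gsect Cf).
apply: filterS (open_nbhs_nbhs (conj (osetP U) Ux)) => z Uz Vz.
by rewrite gsectK -(fE z Uz); exact: (dsect_irr (sval h)).
Qed.

Let preim_point (y : Y) : oset V y -> oset (preim V) (point_of y).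
Proof. by move=> Vy; rewrite /= /preimage /= point_ofK. Qed.

Definition comparison_inv_fun : dsect (fun y : Y => stalk O (set_val y)) V :=
  fun y _ => elem_germ (set_val y) (xget 0 (agrees (point_of y))).

(** Two elements that agree with [h] near a point agree with each other there, hence have the same
    germ by [elem_germP]. *)
Lemma comparison_inv_funE (y : Y) (Vy : oset V y) a :
  agrees (point_of y) a -> comparison_inv_fun Vy = elem_germ (set_val y) a.
Proof.
move=> ha; apply/(elem_germP _ _ (point_ofP y)).
have hb : agrees (point_of y) (xget 0 (agrees (point_of y))).
  exact: xgetPex (agrees_ex (preim_point Vy)).
(* Agreement with [h] is vacuous outside the preimage of [V], so [z] has to stay inside it. *)
have Vn := open_nbhs_nbhs (conj (osetP (preim V)) (preim_point Vy)).
near=> z; have Vz : oset (preim V) z by near: z.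
rewrite -(near ha z _ Vz)// -(near hb z _ Vz)//.
Unshelve. all: by end_near. Qed.

Lemma comparison_inv_subproof : locally_lcb Ylc comparison_inv_fun.
Proof.
apply/asboolP => y Vy; have [a ha] := agrees_ex (preim_point Vy).
pose B : set S :=
  [set x | forall Vx : oset (preim V) x, sval h x Vx = gval a x].
(* The interior ensures that [a] agrees with [h] near each point, not merely at it, so this one
   element serves throughout [N]. *)
pose N : set Y := point_of @^-1` interior B.
have yN : nbhs y N.
  by apply: point_of_continuous; apply: nbhs_interior; exact: ha.
exists (opensI (Opens (open_interior N)) V), (@subIsetr _ _ _); split=> //.
exists (opensT (spec A)), (elem_sect a), (fun _ _ => I) => z Vz.
have [/interior_subset Nz _] := Vz.
exact: comparison_inv_funE.
Qed.

Definition comparison_inv : local_sect Ylc V :=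
  exist (fun s => locally_lcb Ylc s) _ comparison_inv_subproof.

Lemma comparison_invK : comparison comparison_inv = h.
Proof.
apply: val_inj; apply: dsectP => x Vx.
have [a ha] := agrees_ex Vx.
apply: etrans (congr1 (@stalk_value _) (comparison_inv_funE Vx (a := a) _)) _.
  by rewrite real_pointK.
by rewrite stalk_valueE real_pointK; exact/esym/(nbhs_singleton ha Vx).
Qed.

(** Near [y] the section [s] is the family of germs of one [a]. The values of [a] are then those of
    [h] nearby, so the inverse construction returns the germ of [a]. *)
Lemma comparison_inv_unique (s : local_sect Ylc V) :
  comparison s = h -> comparison_inv = s.
Proof.
move=> sh; apply: val_inj; apply: dsectP => y Vy.
have [a sa] := inverse_image_near s Vy.
apply: etrans (esym (nbhs_singleton sa Vy)).
apply: comparison_inv_funE.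
rewrite -{1}(point_ofK y) in sa.
have : nbhs (point_of y) [set x | forall Vz : oset V (real_point x),
    sval s _ Vz = elem_germ (set_val (real_point x)) a].
  exact: real_point_continuous sa.
apply: filterS => x sx Vx.
by rewrite -sh /= sx stalk_valueE real_pointK.
Qed.

End Inverse.

Lemma comparison_bij V : bijective (@comparison V).
Proof.
exists (@comparison_inv V) => [s|h]; last exact: comparison_invK.
exact: comparison_inv_unique.
Qed.

Lemma structure_space_iso : ringed_space_iso (structure_space S) Y.
Proof.
exists real_point, point_of, real_point_continuous; split.
  by split; [exact: point_of_continuous|exact: real_pointK|exact: point_ofK].
exists (fun V => comparison (V := V) : {rmorphism _ -> _}); split.
  exact: comparison_bij.
move=> V W WV s; apply: val_inj; apply: dsectP => x Wx.
(* Both sides evaluate the same germ and differ only in the proof of membership. *)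
exact: (congr1 (@stalk_value _) (dsect_irr (sval s) _ _)).
Qed.

End StratifoldSpectrum.

Theorem theorem3p5 (R : realType) (S : differential_space R)
    (hS : stratifold S) :
  ringed_space_iso (structure_space S) (real_affine_space (global_alg S)).
Proof.
have [[S_lc S_hd S_sc] _ S_bump _ _] := hS.
exact: structure_space_iso.
Qed.
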